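(* Let $(U/J,\Diamond)$ be the diagonal reduction algebra of $\mathfrak{osp}(1|2)$. Any automorphism $\tau$ of this algebra of the form $\tau(\bar x_\beta)=k_\beta\bar x_\beta$ ($\beta\in\{\pm\alpha,\pm2\alpha\}$), $\tau(\bar h)=k_h\bar h$, $\tau(H)=H$, with scalars $k_\beta,k_h\in\mathbb{C}$, is given by $k_h=\epsilon\in\{\pm1\}$, $k_\alpha=\xi$ for some nonzero $\xi\in\mathbb{C}$, $k_{-\alpha}=\xi^{-1}$, $k_{2\alpha}=\epsilon\xi^2$, and $k_{-2\alpha}=\epsilon\xi^{-2}$. Conversely, for any $\epsilon\in\{\pm1\}$ and any nonzero $\xi\in\mathbb{C}$, there is an automorphism $\tau$ given by $\tau(\bar x_{\pm\alpha})=\xi^{\pm1}\bar x_{\pm\alpha}$, $\tau(\bar h)=\epsilon\bar h$, $\tau(\bar x_{\pm2\alpha})=\epsilon\xi^{\pm2}\bar x_{\pm2\alpha}$, and $\tau(H)=H$. The group of these automorphisms is isomorphic to $(\mathbb{Z}/2\mathbb{Z})\times\mathbb{C}^\ast$.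
   Context: Everything is over $\mathbb{C}$; $[\cdot,\cdot]$ is the supercommutator. The Lie superalgebra $\mathfrak{osp}(1|2)$ has even basis elements $x_{-2\alpha},h,x_{2\alpha}$ and odd basis elements $x_{-\alpha},x_\alpha$, with $[h,x_{k\alpha}]=-k\,x_{k\alpha}$ for $k\in\{\pm1,\pm2\}$, $[x_\alpha,x_\alpha]=-2x_{2\alpha}$, $[x_{-\alpha},x_{-\alpha}]=2x_{-2\alpha}$, $[x_\alpha,x_{-2\alpha}]=x_{-\alpha}$, $[x_{-\alpha},x_{2\alpha}]=x_\alpha$, $[x_\alpha,x_{-\alpha}]=h$, $[x_{-2\alpha},x_{2\alpha}]=h$, $[x_\alpha,x_{2\alpha}]=0=[x_{-\alpha},x_{-2\alpha}]$. Let $\mathfrak{G}=\mathfrak{osp}(1|2)\times\mathfrak{osp}(1|2)$. Put $X_{k\alpha}=(x_{k\alpha},x_{k\alpha})$, $H=(h,h)$, $\tilde x_{k\alpha}=(x_{k\alpha},-x_{k\alpha})$, $\tilde h=(h,-h)$. Let $\mathfrak h=\mathbb{C}H$, $\mathfrak g_\pm=\mathbb{C}X_{\pm\alpha}\oplus\mathbb{C}X_{\pm2\alpha}$. Let $D\subset U(\mathfrak h)=\mathbb{C}[H]$ be the multiplicative set generated by $\{H-n\mid n\in\mathbb{Z}\}$, $U=D^{-1}U(\mathfrak G)$ the localization, and $J=\mathfrak g_-U+U\mathfrak g_+$. Define rational functions by $\varphi_0(H)=1$, $\varphi_{2n-1}(H)=\frac{-1}{H-n}\varphi_{2n-2}(H)$,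 $\varphi_{2n}(H)=\frac1n\varphi_{2n-1}(H)$ for $n\ge1$. For $u\in U$ write $\bar u=u+J\in U/J$. The diamond product on $U/J$ is $$\bar u\Diamond\bar v=\sum_{n\ge0}u\,\varphi_n(H)X_{-\alpha}^nX_\alpha^n\,v+J$$ (all but finitely many terms lie in $J$); it is well defined and associative, and $(U/J,\Diamond)$ is (a realization of) the diagonal reduction algebra of $\mathfrak{osp}(1|2)$. Put $\bar x_{k\alpha}=\tilde x_{k\alpha}+J$, $\bar h=\tilde h+J$; elements $f(H)\in D^{-1}U(\mathfrak h)$ are regarded in $U/J$ as $f(H)+J$. This algebra is generated by $D^{-1}U(\mathfrak h)$ and $\bar x_{\pm\alpha},\bar x_{\pm2\alpha},\bar h$. Automorphisms are $\mathbb{C}$-algebra automorphisms. *)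

(* Defs.v *)
From HB Require Import structures.
From mathcomp Require Import all_boot all_order all_algebra.
From mathcomp Require Import boolp classical_sets functions cardinality fsbigop.

Set Implicit Arguments.
Unset Strict Implicit.
Unset Printing Implicit Defensive.
Import Order.TTheory GRing.Theory Num.Theory.
Local Open Scope ring_scope.
Local Open Scope quotient_scope.

(* The associative unital K-algebra with generators X and relations r: formal
   noncommutative polynomial expressions modulo the smallest congruence that
   contains r and makes the quotient a K-algebra. *)
Section Presented.
Variables (K : fieldType) (X : Type).

Inductive ncterm :=
| NCvar of X
| NCconst of K
| NCadd of ncterm & ncterm
| NCmul of ncterm & ncterm.

HB.instance Definition _ := gen_eqMixin ncterm.
HB.instance Definition _ := gen_choiceMixin ncterm.

Variable r : ncterm -> ncterm -> Prop.

Inductive nccong : ncterm -> ncterm -> Prop :=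
| nc_rel s t : r s t -> nccong s t
| nc_refl s : nccong s s
| nc_sym s t : nccong s t -> nccong t s
| nc_trans s t u : nccong s t -> nccong t u -> nccong s u
| nc_add s s' t t' : nccong s s' -> nccong t t' ->
    nccong (NCadd s t) (NCadd s' t')
| nc_mul s s' t t' : nccong s s' -> nccong t t' ->
    nccong (NCmul s t) (NCmul s' t')
| nc_addA s t u : nccong (NCadd s (NCadd t u)) (NCadd (NCadd s t) u)
| nc_addC s t : nccong (NCadd s t) (NCadd t s)
| nc_add0 s : nccong (NCadd (NCconst 0) s) s
| nc_addN s : nccong (NCadd (NCmul (NCconst (-1)) s) s) (NCconst 0)
| nc_mulA s t u : nccong (NCmul s (NCmul t u)) (NCmul (NCmul s t) u)
| nc_mul1 s : nccong (NCmul (NCconst 1) s) s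
| nc_mulDl s t u :
    nccong (NCmul (NCadd s t) u) (NCadd (NCmul s u) (NCmul t u))
| nc_mulDr s t u :
    nccong (NCmul s (NCadd t u)) (NCadd (NCmul s t) (NCmul s u))
| nc_constD a b : nccong (NCconst (a + b)) (NCadd (NCconst a) (NCconst b))
| nc_constM a b : nccong (NCconst (a * b)) (NCmul (NCconst a) (NCconst b))
| nc_constC a s : nccong (NCmul (NCconst a) s) (NCmul s (NCconst a)).

Definition nceq (s t : ncterm) : bool := `[< nccong s t >].

Lemma nceq_equiv : equiv_class_of nceq.
Proof.
split=> [s|s t|t s u].
- exact/asboolP/nc_refl.
- by apply/asboolP/asboolP => /nc_sym.
- by move=> /asboolP st /asboolP tu; apply/asboolP/(nc_trans st tu).
Qed.

Canonical nceq_equivrel := EquivRelPack nceq_equiv.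
Canonical nceq_encModRel := defaultEncModRel nceq.

Definition presented := {eq_quot nceq}.
HB.instance Definition _ : EqQuotient ncterm nceq presented :=
  EqQuotient.on presented.
HB.instance Definition _ := Choice.on presented.

Definition presented_const (a : K) : presented := \pi_presented (NCconst a).
Definition presented_gen (x : X) : presented := \pi_presented (NCvar x).
Definition presented_add (u v : presented) : presented :=
  \pi_presented (NCadd (repr u) (repr v)).
Definition presented_mul (u v : presented) : presented :=
  \pi_presented (NCmul (repr u) (repr v)).

Lemma presented_eq s t : nccong s t -> \pi s = \pi t :> presented.
Proof. by move=> st; apply/eqmodP/asboolP. Qed.

Lemma presented_eqP s t : \pi s = \pi t :> presented -> nccong s t.
Proof. by move/eqmodP/asboolP. Qed.

Lemma nccong_repr s : nccong (repr (\pi s : presented)) s.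
Proof. by apply: presented_eqP; rewrite reprK. Qed.

Lemma pi_presented_add s t :
  presented_add (\pi s) (\pi t) = \pi_presented (NCadd s t).
Proof. by apply/presented_eq/nc_add; apply: nccong_repr. Qed.

Lemma pi_presented_mul s t :
  presented_mul (\pi s) (\pi t) = \pi_presented (NCmul s t).
Proof. by apply/presented_eq/nc_mul; apply: nccong_repr. Qed.

Let piE := (pi_presented_add, pi_presented_mul).

Local Notation pi0 := (presented_const 0).
Local Notation pi1 := (presented_const 1).
Local Notation popp := (presented_mul (presented_const (-1))).

Fact presented_addA : associative presented_add.
Proof. by elim/quotW=> s; elim/quotW=> t; elim/quotW=> u;
  rewrite !piE; apply/presented_eq/nc_addA. Qed.
Fact presented_addC : commutative presented_add.
Proof. by elim/quotW=> s; elim/quotW=> t;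
  rewrite !piE; apply/presented_eq/nc_addC. Qed.
Fact presented_add0 : left_id pi0 presented_add.
Proof. by elim/quotW=> s; rewrite !piE; apply/presented_eq/nc_add0. Qed.
Fact presented_addN : left_inverse pi0 popp presented_add.
Proof.
by elim/quotW=> s; rewrite pi_presented_mul pi_presented_add;
  apply/presented_eq/nc_addN.
Qed.
Fact presented_mulA : associative presented_mul.
Proof. by elim/quotW=> s; elim/quotW=> t; elim/quotW=> u;
  rewrite !piE; apply/presented_eq/nc_mulA. Qed.
Fact presented_constC a u :
  presented_mul (presented_const a) u = presented_mul u (presented_const a).
Proof. by elim/quotW: u => s; rewrite !piE; apply/presented_eq/nc_constC. Qed.
Fact presented_mul1l : left_id pi1 presented_mul.
Proof. by elim/quotW=> s; rewrite !piE; apply/presented_eq/nc_mul1. Qed.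
Fact presented_mul1r : right_id pi1 presented_mul.
Proof. by move=> u; rewrite -presented_constC presented_mul1l. Qed.
Fact presented_mulDl : left_distributive presented_mul presented_add.
Proof. by elim/quotW=> s; elim/quotW=> t; elim/quotW=> u;
  rewrite !piE; apply/presented_eq/nc_mulDl. Qed.
Fact presented_mulDr : right_distributive presented_mul presented_add.
Proof. by elim/quotW=> s; elim/quotW=> t; elim/quotW=> u;
  rewrite !piE; apply/presented_eq/nc_mulDr. Qed.

HB.instance Definition _ := GRing.isZmodule.Build presented
  presented_addA presented_addC presented_add0 presented_addN.
HB.instance Definition _ := GRing.Zmodule_isPzRing.Build presented
  presented_mulA presented_mul1l presented_mul1r presented_mulDl
  presented_mulDr.

Fact presented_constD a b :
  presented_const (a + b) = presented_const a + presented_const b.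
Proof. by rewrite /GRing.add /= piE; apply/presented_eq/nc_constD. Qed.
Fact presented_constM a b :
  presented_const (a * b) = presented_const a * presented_const b.
Proof. by rewrite {2}/GRing.mul /= piE; apply/presented_eq/nc_constM. Qed.

Definition presented_scale (a : K) (u : presented) := presented_const a * u.

Fact presented_scaleA a b u :
  presented_scale a (presented_scale b u) = presented_scale (a * b) u.
Proof. by rewrite /presented_scale mulrA presented_constM. Qed.
Fact presented_scale1 : left_id 1 presented_scale.
Proof. exact: presented_mul1l. Qed.
Fact presented_scaleDr : right_distributive presented_scale +%R.
Proof. by move=> a u v; apply: mulrDr. Qed.
Fact presented_scaleDl u : {morph presented_scale^~ u : a b / a + b}.
Proof. by move=> a b; rewrite /presented_scale presented_constD mulrDl. Qed.

HB.instance Definition _ := GRing.Zmodule_isLmodule.Build K presented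
  presented_scaleA presented_scale1 presented_scaleDr presented_scaleDl.

Lemma presented_scaleAl a (u v : presented) : a *: (u * v) = (a *: u) * v.
Proof. exact: mulrA. Qed.
Lemma presented_scaleAr a (u v : presented) : a *: (u * v) = u * (a *: v).
Proof.
rewrite /GRing.scale /= /presented_scale !mulrA.
by congr (_ * _); apply: presented_constC.
Qed.

Lemma presented_constE a : presented_const a = a *: (1 : presented).
Proof. by rewrite -[LHS]mulr1. Qed.

Lemma pi_ncadd s t :
  \pi_presented (NCadd s t) = \pi_presented s + \pi_presented t.
Proof. by rewrite -pi_presented_add. Qed.
Lemma pi_ncmul s t :
  \pi_presented (NCmul s t) = \pi_presented s * \pi_presented t.
Proof. by rewrite -pi_presented_mul. Qed.
Lemma pi_ncconst a : \pi_presented (NCconst a) = a *: (1 : presented).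
Proof. exact: presented_constE. Qed.

Lemma presented_ind (P : presented -> Prop) :
  (forall x, P (presented_gen x)) -> (forall a, P (a *: (1 : presented))) ->
  (forall u v, P u -> P v -> P (u + v)) ->
  (forall u v, P u -> P v -> P (u * v)) -> forall u, P u.
Proof.
move=> Pg Pc PD PM; elim/quotW; elim=> [x|a|s Ps t Pt|s Ps t Pt].
- exact: Pg.
- by rewrite pi_ncconst.
- by rewrite pi_ncadd; apply: PD.
- by rewrite pi_ncmul; apply: PM.
Qed.

End Presented.

Arguments NCconst {K X} _.

(* U(L) for a Lie superalgebra L, where [homog p x] says that x is homogeneous
   of parity p ([true] meaning odd).  Elements of L are the generators; the
   first family of relations makes L -> U(L) linear. *)
Section Enveloping.
Variables (K : fieldType) (L : lmodType K).
Variables (homog : bool -> L -> Prop) (br : L -> L -> L).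

Inductive env_rel : ncterm K L -> ncterm K L -> Prop :=
| env_linear (a : K) x y :
    env_rel (NCvar K (a *: x + y))
      (NCadd (NCmul (NCconst a) (NCvar K x)) (NCvar K y))
| env_bracket p q x y : homog p x -> homog q y ->
    env_rel (NCmul (NCvar K x) (NCvar K y))
      (NCadd (NCvar K (br x y))
         (NCmul (NCconst ((-1) ^+ (p && q))) (NCmul (NCvar K y) (NCvar K x)))).

Definition enveloping := presented env_rel.
HB.instance Definition _ := GRing.PzRing.on enveloping.
HB.instance Definition _ := GRing.Lmodule.on enveloping.

Definition env_in (x : L) : enveloping := presented_gen env_rel x.

Lemma env_inP a x y : env_in (a *: x + y) = a *: env_in x + env_in y.
Proof.
rewrite [LHS](presented_eq (nc_rel (env_linear a x y))).
rewrite pi_ncadd pi_ncmul pi_ncconst.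
by rewrite -presented_scaleAl mul1r.
Qed.

Lemma env_inC p q x y : homog p x -> homog q y ->
  env_in x * env_in y =
  env_in (br x y) + (-1) ^+ (p && q) *: (env_in y * env_in x).
Proof.
move=> hx hy; rewrite /env_in /presented_gen -pi_ncmul.
rewrite [LHS](presented_eq (nc_rel (env_bracket hx hy))).
by rewrite pi_ncadd pi_ncmul pi_ncconst pi_ncmul -presented_scaleAl mul1r.
Qed.

End Enveloping.

(* The localization of a K-algebra A at a subset D: the universal K-algebra
   under A in which the elements of D become invertible.  When D is an Ore set
   it is the usual ring of fractions D^-1 A. *)
Section Localization.
Variables (K : fieldType) (Y : Type) (r : ncterm K Y -> ncterm K Y -> Prop).
Local Notation A := (presented r).
Variable D : A -> Prop.
Let X := (A + {d : A | D d})%type.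
Let inA (u : A) : ncterm K X := NCvar K (inl u).
Let invD (d : {d : A | D d}) : ncterm K X := NCvar K (inr d).

Inductive loc_rel : ncterm K X -> ncterm K X -> Prop :=
| loc_const a : loc_rel (inA (a *: (1 : A))) (NCconst a)
| loc_add u v : loc_rel (inA (u + v)) (NCadd (inA u) (inA v))
| loc_mul u v : loc_rel (inA (u * v)) (NCmul (inA u) (inA v))
| loc_mulV d : loc_rel (NCmul (inA (sval d)) (invD d)) (NCconst 1)
| loc_mulV' d : loc_rel (NCmul (invD d) (inA (sval d))) (NCconst 1).

Definition localization := presented loc_rel.
HB.instance Definition _ := GRing.PzRing.on localization.
HB.instance Definition _ := GRing.Lmodule.on localization.

Definition loc_in (u : A) : localization := presented_gen loc_rel (inl u).
Definition loc_inv (d : {d : A | D d}) : localization :=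
  presented_gen loc_rel (inr d).

Lemma loc_inZ1 a : loc_in (a *: (1 : A)) = a *: (1 : localization).
Proof.
rewrite [LHS](presented_eq (nc_rel (loc_const a))).
by rewrite pi_ncconst.
Qed.
Lemma loc_inD u v : loc_in (u + v) = loc_in u + loc_in v.
Proof.
rewrite [LHS](presented_eq (nc_rel (loc_add u v))).
by rewrite pi_ncadd.
Qed.
Lemma loc_inM u v : loc_in (u * v) = loc_in u * loc_in v.
Proof.
rewrite [LHS](presented_eq (nc_rel (loc_mul u v))).
by rewrite pi_ncmul.
Qed.
Lemma loc_inZ a u : loc_in (a *: u) = a *: loc_in u.
Proof.
rewrite -[u in LHS]mul1r presented_scaleAl loc_inM loc_inZ1.
by rewrite -presented_scaleAl mul1r.
Qed.
Lemma loc_in1 : loc_in 1 = 1.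
Proof. by rewrite -[1 in LHS]scale1r loc_inZ1 scale1r. Qed.
Lemma loc_mulVr d : loc_in (sval d) * loc_inv d = 1.
Proof.
rewrite /loc_in /loc_inv /presented_gen -pi_ncmul.
rewrite (presented_eq (nc_rel (loc_mulV d))).
by rewrite pi_ncconst scale1r.
Qed.
Lemma loc_mulrV d : loc_inv d * loc_in (sval d) = 1.
Proof.
rewrite /loc_in /loc_inv /presented_gen -pi_ncmul.
rewrite (presented_eq (nc_rel (loc_mulV' d))).
by rewrite pi_ncconst scale1r.
Qed.

End Localization.

(* The weight vectors x_{-2 alpha}, x_{-alpha}, h, x_alpha, x_{2 alpha} *)
Inductive osp_basis := xm2 | xm1 | xh | xp1 | xp2.

Definition osp_basis_pickle (b : osp_basis) : 'I_5 :=
  match b with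
  | xm2 => @Ordinal 5 0 isT | xm1 => @Ordinal 5 1 isT | xh => @Ordinal 5 2 isT
  | xp1 => @Ordinal 5 3 isT | xp2 => @Ordinal 5 4 isT
  end.
Definition osp_basis_unpickle (i : 'I_5) : osp_basis :=
  nth xh [:: xm2; xm1; xh; xp1; xp2] i.
Lemma osp_basis_pickleK : cancel osp_basis_pickle osp_basis_unpickle.
Proof. by case. Qed.

HB.instance Definition _ := Equality.copy osp_basis (can_type osp_basis_pickleK).
HB.instance Definition _ := Choice.copy osp_basis (can_type osp_basis_pickleK).
HB.instance Definition _ := Countable.copy osp_basis (can_type osp_basis_pickleK).
HB.instance Definition _ := Finite.copy osp_basis (can_type osp_basis_pickleK).

Section Osp.
Variable K : numFieldType.

Definition osp := {ffun osp_basis -> K^o}.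
HB.instance Definition _ := GRing.Lmodule.on osp.

Definition osp_e (b : osp_basis) : osp := [ffun c => (c == b)%:R].

Definition weight (b : osp_basis) : int :=
  match b with xm2 => -2 | xm1 => -1 | xh => 0 | xp1 => 1 | xp2 => 2 end.

(* parity: [true] is odd *)
Definition odd_basis (b : osp_basis) : bool :=
  match b with xm1 | xp1 => true | _ => false end.

(* The entries [b, a] missing from the usual table are given by super
   skew-symmetry, [b, a] = - (-1)^(|a||b|) [a, b]. *)
Definition osp_br_basis (a b : osp_basis) : osp :=
  match a, b with
  | xh, b => (- weight b)%:~R *: osp_e b
  | a, xh => (weight a)%:~R *: osp_e a
  | xp1, xp1 => (- 2) *: osp_e xp2
  | xm1, xm1 => 2 *: osp_e xm2
  | xp1, xm2 => osp_e xm1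
  | xm2, xp1 => - osp_e xm1
  | xm1, xp2 => osp_e xp1
  | xp2, xm1 => - osp_e xp1
  | xp1, xm1 | xm1, xp1 => osp_e xh
  | xm2, xp2 => osp_e xh
  | xp2, xm2 => - osp_e xh
  | _, _ => 0
  end.

Definition osp_br (x y : osp) : osp :=
  \sum_a \sum_b (x a * y b) *: osp_br_basis a b.

Definition osp2 := (osp * osp)%type.
HB.instance Definition _ := GRing.Lmodule.on osp2.

Definition osp2_br (x y : osp2) : osp2 := (osp_br x.1 y.1, osp_br x.2 y.2).

Definition osp2_homog (p : bool) (x : osp2) : Prop :=
  forall b, odd_basis b != p -> x.1 b = 0 /\ x.2 b = 0.

Definition UG := enveloping osp2_homog osp2_br.
HB.instance Definition _ := GRing.PzRing.on UG.
HB.instance Definition _ := GRing.Lmodule.on UG.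

Definition UG_in (x : osp2) : UG := env_in osp2_homog osp2_br x.

(* the image in U(G) of the diagonal element H = (h, h) *)
Definition UG_H : UG := UG_in (osp_e xh, osp_e xh).

(* the multiplicative set generated by the H - n *)
Inductive Dset : UG -> Prop :=
| Dset1 : Dset 1
| DsetM d (n : int) : Dset d -> Dset (d * (UG_H - n%:~R)).

Definition Uloc := localization Dset.
HB.instance Definition _ := GRing.PzRing.on Uloc.
HB.instance Definition _ := GRing.Lmodule.on Uloc.

Definition Uloc_in (u : UG) : Uloc := loc_in Dset u.

(* Xdiag b and Xtilde b are the images in U of (x_b, x_b) and (x_b, - x_b). *)
Definition Xdiag (b : osp_basis) : Uloc := Uloc_in (UG_in (osp_e b, osp_e b)).
Definition Xtilde (b : osp_basis) : Uloc :=
  Uloc_in (UG_in (osp_e b, - osp_e b)).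
Definition Hdiag : Uloc := Xdiag xh.

Lemma Dset_gen (n : int) : Dset (UG_H - n%:~R).
Proof. by rewrite -[_ - _]mul1r; apply/DsetM/Dset1. Qed.

(* (H - n)^-1 *)
Definition Hinv (n : int) : Uloc :=
  loc_inv (exist Dset (UG_H - n%:~R) (Dset_gen n)).

(* phi_(2m-1)(H) = - phi_(2m-2)(H) / (H - m), phi_(2m)(H) = phi_(2m-1)(H) / m;
   in both cases m = uphalf n. *)
Fixpoint dra_phi (n : nat) : Uloc :=
  if n is n'.+1 then
    if odd n then - Hinv (uphalf n)%:Z * dra_phi n'
    else ((uphalf n)%:R^-1 : K) *: dra_phi n'
  else 1.

(* J = g_- U + U g_+ *)
Definition inJ (u : Uloc) : Prop :=
  exists a b c d,
    u = Xdiag xm1 * a + Xdiag xm2 * b + c * Xdiag xp1 + d * Xdiag xp2.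

End Osp.

Section AbsorbingPowers.
Variables (A : pzRingType) (x : A).

Definition absorbed (v : A) : Prop :=
  forall k, exists N, forall n, (N <= n)%N -> exists y, x ^+ n * v = y * x ^+ k.

Lemma absorbed_comm v : GRing.comm x v -> absorbed v.
Proof.
move=> xv k; exists k => n kn; exists (x ^+ (n - k) * v).
by rewrite -mulrA (commrX k (commr_sym xv)) mulrA -exprD subnK.
Qed.

Lemma absorbedD u v : absorbed u -> absorbed v -> absorbed (u + v).
Proof.
move=> Au Av k; have [N hN] := Au k; have [M hM] := Av k.
exists (maxn N M) => n; rewrite geq_max => /andP[/hN[y yE] /hM[z zE]].
by exists (y + z); rewrite mulrDr yE zE mulrDl.
Qed.

Lemma absorbedM u v : absorbed u -> absorbed v -> absorbed (u * v).
Proof.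
move=> Au Av k; have [M hM] := Av k; have [N hN] := Au M.
exists N => n /hN[y yE]; have [z zE] := hM M (leqnn M).
by exists (y * z); rewrite mulrA yE -mulrA zE mulrA.
Qed.

Lemma absorbed_step (b : bool) v f :
  absorbed f -> x * v = (-1) ^+ b * (v * x) + f -> absorbed v.
Proof.
move=> Af xv; elim=> [|k [N hN]].
  by exists 0 => n _; exists (x ^+ n * v); rewrite mulr1.
have [M hM] := Af k.+1; exists (maxn N M).+1 => -[//|n].
rewrite ltnS geq_max => /andP[/hN[y yE] /hM[z zE]].
exists ((-1) ^+ b * y + z); rewrite exprSr -mulrA xv mulrDr zE mulrDl.
congr (_ + _); rewrite mulrA (commr_sign (x ^+ n) b) -!mulrA; congr (_ * _).
by rewrite mulrA yE -mulrA -exprSr.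
Qed.

Lemma absorbed_family (I : Type) (e : I -> A) :
  (forall i, exists j, x * e i = e j * x) -> forall i, absorbed (e i).
Proof.
move=> xe i k; exists k => n kn.
suff [j ->]: exists j, x ^+ n * e i = e j * x ^+ n.
  by exists (e j * x ^+ (n - k)); rewrite -mulrA -exprD subnK.
elim: n {kn} => [|n [j IHn]]; first by exists i; rewrite mul1r mulr1.
have [l xl] := xe j; exists l.
by rewrite exprS -mulrA IHn mulrA xl -mulrA.
Qed.

End AbsorbingPowers.

Lemma expr_converse (A : pzRingType) (x : A) n : (x : A^c) ^+ n = x ^+ n :> A.
Proof. by elim: n => // n IHn; rewrite exprS exprSr IHn. Qed.

Section AbsorbingPowersRight.
Variables (A : pzRingType) (x : A).

Definition absorbed_r (v : A) : Prop :=
  forall k, exists N, forall n, (N <= n)%N -> exists y, v * x ^+ n = x ^+ k * y.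

Lemma absorbed_rE v : absorbed_r v <-> @absorbed A^c x v.
Proof.
split=> Av k; have [N hN] := Av k; exists N => n /hN[y E]; exists y.
  by rewrite !expr_converse; exact: E.
by move: E; rewrite !expr_converse.
Qed.

Lemma absorbed_r_comm v : GRing.comm x v -> absorbed_r v.
Proof. by move=> xv; apply/absorbed_rE/absorbed_comm; apply: esym xv. Qed.

Lemma absorbed_rD u v : absorbed_r u -> absorbed_r v -> absorbed_r (u + v).
Proof.
move=> /absorbed_rE Au /absorbed_rE Av; apply/absorbed_rE.
exact: absorbedD Au Av.
Qed.

Lemma absorbed_rM u v : absorbed_r u -> absorbed_r v -> absorbed_r (u * v).
Proof.
move=> /absorbed_rE Au /absorbed_rE Av; apply/absorbed_rE.
exact: absorbedM Av Au.
Qed.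

Lemma absorbed_r_step (b : bool) v f :
  absorbed_r f -> v * x = (-1) ^+ b * (x * v) + f -> absorbed_r v.
Proof.
move=> /absorbed_rE Af E; apply/absorbed_rE/(@absorbed_step A^c x b v f Af).
rewrite -[LHS]/(v * x) expr_converse -[X in X + _]/((x * v) * (-1) ^+ b) E.
by rewrite commr_sign.
Qed.

Lemma absorbed_r_family (I : Type) (e : I -> A) :
  (forall i, exists j, e i * x = x * e j) -> forall i, absorbed_r (e i).
Proof.
by move=> xe i; apply/absorbed_rE/(@absorbed_family A^c x I e xe i).
Qed.

End AbsorbingPowersRight.

(* The telescoping identities behind P X_- = 0 = X_+ P for the extremal
   projector P = \sum_n phi_n X_-^n X_+^n. *)
Section Telescope.
Variables (A : pzRingType) (xp xm h : A).
Hypothesis xpm : xp * xm = h - xm * xp.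
Hypothesis xph : xp * h = h * xp + xp.
Hypothesis xmh : xm * h = h * xm - xm.

Lemma xm_exp_h n : xm ^+ n * h = h * xm ^+ n - xm ^+ n *+ n.
Proof.
elim: n => [|n IHn]; first by rewrite mul1r mulr1 subr0.
rewrite exprS -mulrA IHn mulrBr mulrA xmh mulrBl mulrnAr -mulrA -exprS mulrS.
by rewrite opprD addrA.
Qed.

Lemma xp_exp_xm n :
  xp ^+ n.*2 * xm = xm * xp ^+ n.*2 + xp ^+ n.*2.-1 *+ n /\
  xp ^+ n.*2.+1 * xm = - (xm * xp ^+ n.*2.+1) + h * xp ^+ n.*2 + xp ^+ n.*2 *+ n.
Proof.
have odd_of_even m : xp ^+ m.*2 * xm = xm * xp ^+ m.*2 + xp ^+ m.*2.-1 *+ m ->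
  xp ^+ m.*2.+1 * xm = - (xm * xp ^+ m.*2.+1) + h * xp ^+ m.*2 + xp ^+ m.*2 *+ m.
  move=> ev.
  have E1 : xp * (xp ^+ m.*2.-1 *+ m) = xp ^+ m.*2 *+ m.
    by case: m {ev} => [|m]; rewrite ?mulr0n ?mulr0 // mulrnAr -exprS.
  have -> : xp ^+ m.*2.+1 * xm = xp * (xp ^+ m.*2 * xm) by rewrite exprS mulrA.
  rewrite ev mulrDr E1 mulrA xpm mulrBl -[xm * xp * _]mulrA -exprS.
  by rewrite [- _ + _]addrC.
elim: n => [|n [IHe IHo]].
  have ev0 : xp ^+ 0.*2 * xm = xm * xp ^+ 0.*2 + xp ^+ 0.*2.-1 *+ 0.
    by rewrite double0 expr0 mul1r mulr1 mulr0n addr0.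
  by split; [|apply: odd_of_even].
have ev : xp ^+ n.+1.*2 * xm = xm * xp ^+ n.+1.*2 + xp ^+ n.+1.*2.-1 *+ n.+1.
  have -> : xp ^+ n.+1.*2 * xm = xp * (xp ^+ n.*2.+1 * xm).
    by rewrite doubleS [_ ^+ _.+2]exprS mulrA.
  have E1 : xp * (xm * xp ^+ n.*2.+1) = h * xp ^+ n.*2.+1 - xm * xp ^+ n.+1.*2.
    by rewrite mulrA xpm mulrBl -[xm * xp * _]mulrA -exprS -doubleS.
  have E2 : xp * (h * xp ^+ n.*2) = h * xp ^+ n.*2.+1 + xp ^+ n.*2.+1.
    by rewrite mulrA xph mulrDl -!mulrA -!exprS.
  rewrite IHo !mulrDr mulrN E1 E2 mulrnAr -exprS opprB mulrS /=.
  by rewrite -addrA [_ - h * _]addrC -!addrA addrCA !addrA subrK.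
by split; [|apply: odd_of_even].
Qed.

Lemma xp_xm_exp n :
  xp * xm ^+ n.*2 = xm ^+ n.*2 * xp + xm ^+ n.*2.-1 *+ n /\
  xp * xm ^+ n.*2.+1 =
    - (xm ^+ n.*2.+1 * xp) + h * xm ^+ n.*2 - xm ^+ n.*2 *+ n.
Proof.
have odd_of_even m : xp * xm ^+ m.*2 = xm ^+ m.*2 * xp + xm ^+ m.*2.-1 *+ m ->
  xp * xm ^+ m.*2.+1 =
    - (xm ^+ m.*2.+1 * xp) + h * xm ^+ m.*2 - xm ^+ m.*2 *+ m.
  move=> ev.
  have E1 : xm ^+ m.*2.-1 *+ m * xm = xm ^+ m.*2 *+ m.
    by case: m {ev} => [|m]; rewrite ?mulr0n ?mul0r // mulrnAl -exprSr.
  have -> : xp * xm ^+ m.*2.+1 = (xp * xm ^+ m.*2) * xm by rewrite exprSr mulrA.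
  rewrite ev mulrDl E1 -mulrA xpm mulrBr xm_exp_h mulrA -exprSr.
  rewrite -addnn mulrnDr; set a := h * _; set b := _ *+ m; set c := _ * xp.
  by rewrite opprD [a + _]addrA [_ - c]addrC -!addrA addNr addr0.
elim: n => [|n [IHe IHo]].
  have ev0 : xp * xm ^+ 0.*2 = xm ^+ 0.*2 * xp + xm ^+ 0.*2.-1 *+ 0.
    by rewrite double0 expr0 mul1r mulr1 mulr0n addr0.
  by split; [|apply: odd_of_even].
have ev : xp * xm ^+ n.+1.*2 = xm ^+ n.+1.*2 * xp + xm ^+ n.+1.*2.-1 *+ n.+1.
  have -> : xp * xm ^+ n.+1.*2 = xp * xm ^+ n.*2.+1 * xm.
    by rewrite doubleS [_ ^+ _.+2]exprSr mulrA.
  have E1 : xm ^+ n.*2.+1 * xp * xm =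
            h * xm ^+ n.*2.+1 - xm ^+ n.*2.+1 *+ n.*2.+1 - xm ^+ n.+1.*2 * xp.
    by rewrite -mulrA xpm mulrBr xm_exp_h mulrA -exprSr -doubleS.
  rewrite IHo !mulrDl !mulNr E1 -[h * _ * xm]mulrA mulrnAl -!exprSr /=.
  rewrite [_ *+ n.*2.+1]mulrS [_ *+ n.+1]mulrS -addnn mulrnDr.
  set a := h * _; set b := _ *+ n; set c := _ * xp; set d := xm ^+ _.
  have -> : - (a - (d + (b + b)) - c) = c + (d + b) + b - a.
    by rewrite !opprB !addrA.
  by rewrite subrK addrK.
by split; [|apply: odd_of_even].
Qed.

Section Right.
Variable f : nat -> A.
Hypothesis f_odd : forall m, f m.*2.+1 * (h - m.+1%:R) = - f m.*2.
Hypothesis f_even : forall m, f m.+1.*2 *+ m.+1 = f m.*2.+1.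

Lemma telescope_xm N :
  \sum_(n < N.+1) f n * xm ^+ n * xp ^+ n * xm =
  (-1) ^+ N * (f N * xm ^+ N.+1 * xp ^+ N).
Proof.
elim: N => [|N IHN].
  by rewrite big_ord1 expr0 !mul1r !mulr1.
rewrite big_ord_recr /= IHN; have := odd_double_half N.
case: (odd N) => <-; rewrite ?add0n ?add1n; move: (N./2) => m.
- rewrite -doubleS -[_ * xp ^+ _ * xm]mulrA (xp_exp_xm m.+1).1 mulrDr mulrnAr.
  rewrite -signr_odd /= odd_double mulN1r -signr_odd odd_double mul1r.
  rewrite -[in X in _ + (_ + X)]mulrnAl -[in X in _ + (_ + X)]mulrnAl f_even.
  rewrite addrCA addNr addr0; move: (m.+1.*2) => e.
  by rewrite !mulrA -[_ * xm ^+ _ * xm]mulrA -exprSr.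
- rewrite -[_ * xp ^+ _ * xm]mulrA (xp_exp_xm m).2 -addrA mulrDr mulrN.
  rewrite -signr_odd odd_double mul1r -signr_odd /= odd_double mulN1r.
  have -> : h * xp ^+ m.*2 + xp ^+ m.*2 *+ m = (h + m%:R) * xp ^+ m.*2.
    by rewrite mulrDl mulr_natl.
  have E : f m.*2.+1 * xm ^+ m.*2.+1 * (h + m%:R) =
           f m.*2.+1 * (h - m.+1%:R) * xm ^+ m.*2.+1.
    rewrite -!mulrA; congr (_ * _); rewrite mulrDr xm_exp_h mulrBl.
    rewrite mulr_natr mulr_natl -addrA; congr (_ + _).
    by rewrite -addnn -addnS mulrnDr opprD addrAC addNr add0r.
  rewrite [_ * ((h + _) * _)]mulrA E f_odd !mulNr addrCA subrr addr0.
  congr (- _); move: (m.*2.+1) => e.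
  by rewrite !mulrA -[_ * xm ^+ _ * xm]mulrA -exprSr.
Qed.
End Right.

Section Left.
Variable g : nat -> A.
Hypothesis g_odd : forall m, g m.*2.+1 * (h - m%:R) = - g m.*2.
Hypothesis g_even : forall m, g m.+1.*2 *+ m.+1 = g m.*2.+1.

Lemma telescope_xp N :
  \sum_(n < N.+1) g n * xp * xm ^+ n * xp ^+ n =
  (-1) ^+ N * (g N * xm ^+ N * xp ^+ N.+1).
Proof.
elim: N => [|N IHN]; first by rewrite big_ord1 expr0 !mul1r !mulr1.
rewrite big_ord_recr /= IHN; have := odd_double_half N.
case: (odd N) => <-; rewrite ?add0n ?add1n; move: (N./2) => m.
- rewrite -doubleS -[g _ * xp * _]mulrA (xp_xm_exp m.+1).1 mulrDr mulrDl.
  rewrite mulrnAr -mulrnAl g_even /=.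
  rewrite -signr_odd /= odd_double mulN1r -signr_odd odd_double mul1r.
  by rewrite addrCA addNr addr0 !mulrA -[_ * xp * _]mulrA -exprS.
- rewrite -[g _ * xp * _]mulrA (xp_xm_exp m).2 -addrA mulrDr mulrN mulrDl.
  rewrite -signr_odd odd_double mul1r -signr_odd /= odd_double mulN1r mulNr.
  rewrite addrCA -[RHS]addr0 !mulrA -[_ * xp * _]mulrA -exprS; congr (_ + _).
  rewrite -mulr_natl -mulrBl mulrA g_odd !mulNr.
  by rewrite subrr.
Qed.
End Left.
End Telescope.

Section UlocTheory.
Variable K : numFieldType.
Local Notation U := (Uloc K).
Local Notation e b := (osp_e K b).
Local Notation xp := (Xdiag K xp1).
Local Notation xm := (Xdiag K xm1).
Local Notation h := (Hdiag K).

Lemma osp_br_e a b : osp_br (e a) (e b) = osp_br_basis K a b.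
Proof.
rewrite /osp_br (bigD1 a) //= [X in _ + X]big1 => [|i ia].
  rewrite addr0 (bigD1 b) //= [X in _ + X]big1 => [|j jb].
    by rewrite addr0 !ffunE !eqxx mulr1 scale1r.
  by rewrite !ffunE (negPf jb) mulr0 scale0r.
by apply: big1 => j _; rewrite !ffunE (negPf ia) mul0r scale0r.
Qed.

Lemma osp_br_r0 x : osp_br x 0 = 0 :> osp K.
Proof. by apply: big1 => a _; apply: big1 => b _; rewrite ffunE mulr0 scale0r. Qed.

Definition Uin (x : osp2 K) : U := Uloc_in (UG_in x).

Lemma Uin_lin a x y : Uin (a *: x + y) = a *: Uin x + Uin y.
Proof. by rewrite /Uin /UG_in env_inP [LHS]loc_inD loc_inZ. Qed.

Lemma Uin0 : Uin 0 = 0.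
Proof.
have := Uin_lin (-1) 0 0; rewrite scaler0 addr0 scaleN1r addNr.
by [].
Qed.
Lemma UinD x y : Uin (x + y) = Uin x + Uin y.
Proof. by rewrite -[x in LHS]scale1r Uin_lin scale1r. Qed.
Lemma UinZ a x : Uin (a *: x) = a *: Uin x.
Proof. by rewrite -[_ *: x]addr0 Uin_lin Uin0 addr0. Qed.

Lemma Uin_sum (I : Type) (r : seq I) (F : I -> osp2 K) :
  Uin (\sum_(i <- r) F i) = \sum_(i <- r) Uin (F i).
Proof. exact: (big_morph Uin UinD Uin0). Qed.

Lemma UinC p q x y : osp2_homog p x -> osp2_homog q y ->
  Uin x * Uin y = Uin (osp2_br x y) + (-1) ^+ (p && q) *: (Uin y * Uin x).
Proof.
move=> hx hy; rewrite /Uin /Uloc_in -loc_inM /UG_in (env_inC _ hx hy).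
by rewrite [LHS]loc_inD loc_inZ loc_inM.
Qed.

Lemma homog_e b c1 c2 :
  osp2_homog (odd_basis b) ((c1 *: e b, c2 *: e b) : osp2 K).
Proof.
move=> c; rewrite !ffunE.
by have [->|_ _] := eqVneq c b; rewrite ?eqxx // !scaler0.
Qed.

Lemma homog_ed b : osp2_homog (odd_basis b) ((e b, e b) : osp2 K).
Proof. by have := @homog_e b 1 1; rewrite !scale1r. Qed.
Lemma homog_el b : osp2_homog (odd_basis b) ((e b, 0) : osp2 K).
Proof. by have := @homog_e b 1 0; rewrite scale1r scale0r. Qed.
Lemma homog_er b : osp2_homog (odd_basis b) ((0, e b) : osp2 K).
Proof. by have := @homog_e b 0 1; rewrite scale1r scale0r. Qed.

Lemma X_comm a b :
  Xdiag K a * Xdiag K b = Uin (osp_br_basis K a b, osp_br_basis K a b) +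
    (-1) ^+ (odd_basis a && odd_basis b) *: (Xdiag K b * Xdiag K a).
Proof. by rewrite [LHS](UinC (@homog_ed a) (@homog_ed b)) /osp2_br /= !osp_br_e. Qed.

Lemma X_lcomm a b :
  Xdiag K a * Uin (e b, 0) = Uin (osp_br_basis K a b, 0) +
    (-1) ^+ (odd_basis a && odd_basis b) *: (Uin (e b, 0) * Xdiag K a).
Proof. by rewrite [LHS](UinC (@homog_ed a) (@homog_el b)) /osp2_br /= osp_br_e osp_br_r0. Qed.

Lemma X_rcomm a b :
  Xdiag K a * Uin (0, e b) = Uin (0, osp_br_basis K a b) +
    (-1) ^+ (odd_basis a && odd_basis b) *: (Uin (0, e b) * Xdiag K a).
Proof. by rewrite [LHS](UinC (@homog_ed a) (@homog_er b)) /osp2_br /= osp_br_e osp_br_r0. Qed.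

Lemma UinZd a x : Uin (a *: x, a *: x) = a *: Uin (x, x).
Proof. by rewrite -UinZ. Qed.

Lemma xpm : xp * xm = h - xm * xp.
Proof. by rewrite [LHS]X_comm /= expr1 scaleN1r. Qed.

Lemma xph : xp * h = h * xp + xp.
Proof. by rewrite [LHS]X_comm /= expr0 !scale1r addrC. Qed.

Lemma xmh : xm * h = h * xm - xm.
Proof.
by rewrite [LHS]X_comm /= expr0 scale1r addrC UinZd scaleN1r.
Qed.

Lemma X2E (a b : osp_basis) (c : K) : c != 0 -> odd_basis a ->
  osp_br_basis K a a = (c *+ 2) *: e b -> Xdiag K a * Xdiag K a = c *: Xdiag K b.
Proof.
move=> c0 oa ab; have := X_comm a a; rewrite oa ab /= expr1 scaleN1r UinZd.
move=> E; have : Xdiag K a * Xdiag K a *+ 2 = (c *+ 2) *: Xdiag K b.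
  by rewrite mulr2n {1}E subrK.
rewrite -[in LHS]scaler_nat -[c *+ 2]mulr_natl.
move/(congr1 (fun v => (2^-1 : K) *: v)).
by rewrite !scalerA mulKf ?pnatr_eq0 // mulVf ?pnatr_eq0 // scale1r.
Qed.

Lemma X_p2 : Xdiag K xp2 = - (xp * xp).
Proof.
rewrite (@X2E xp1 xp2 (-1)) ?scaleN1r ?opprK ?oppr_eq0 ?oner_eq0 //.
by rewrite mulNrn.
Qed.

Lemma X_m2 : Xdiag K xm2 = xm * xm.
Proof. by rewrite (@X2E xm1 xm2 1) ?scale1r ?oner_eq0. Qed.

Lemma inJP (u : U) : inJ u <-> exists a b, u = xm * a + b * xp.
Proof.
split=> [[a [b [c [d ->]]]]|[a [b ->]]].
  exists (a + xm * b), (c - d * xp); rewrite X_m2 X_p2 mulrN mulrDr mulrBl.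
  by rewrite !mulrA addrA.
by exists a, 0, b, 0; rewrite mulr0 mul0r !addr0.
Qed.

Lemma inJ_l a : inJ (xm * a : U).
Proof. by apply/inJP; exists a, 0; rewrite mul0r addr0. Qed.
Lemma inJ_r a : inJ (a * xp : U).
Proof. by apply/inJP; exists 0, a; rewrite mulr0 add0r. Qed.

Lemma inJ0 : inJ (0 : U).
Proof. by rewrite -(mulr0 xm); apply: inJ_l. Qed.
Lemma inJB u v : inJ u -> inJ v -> inJ (u - v : U).
Proof.
move=> /inJP[a [b ->]] /inJP[c [d ->]]; apply/inJP.
by exists (a - c), (b - d); rewrite mulrBr mulrBl addrACA opprD.
Qed.
Lemma inJD u v : inJ u -> inJ v -> inJ (u + v : U).
Proof.
by move=> Ju Jv; rewrite -[v]opprK -(sub0r v); apply/inJB/inJB/Jv/inJ0.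
Qed.
Lemma inJZ a u : inJ u -> inJ (a *: u : U).
Proof.
move=> /inJP[b [c ->]]; apply/inJP; exists (a *: b), (a *: c).
by rewrite scalerDr (presented_scaleAr a xm) (presented_scaleAl a c).
Qed.

Lemma UG_H_in (n : int) : Uloc_in (UG_H K - n%:~R) = h - n%:~R.
Proof.
rewrite [LHS]loc_inD; congr (_ + _).
rewrite -!mulrNz.
have -> : (1 : UG K) *~ (- n) = ((- n)%:~R : K) *: (1 : UG K) by rewrite scaler_int.
have -> : (1 : U) *~ (- n) = ((- n)%:~R : K) *: (1 : U) by rewrite scaler_int.
exact: loc_inZ1.
Qed.

Lemma natr_comm n (u : U) : n%:R * u = u * n%:R.
Proof. by rewrite mulr_natl mulr_natr. Qed.
Lemma intr_comm (n : int) (u : U) : n%:~R * u = u * n%:~R.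
Proof. by rewrite mulrzl mulrzr. Qed.

Lemma HinvP n : (h - n%:~R) * Hinv K n = 1 /\ Hinv K n * (h - n%:~R) = 1.
Proof.
set d := exist (@Dset K) _ (Dset_gen K n).
by split; rewrite -UG_H_in; [exact: (loc_mulVr d) | exact: (loc_mulrV d)].
Qed.

Lemma xp_shift (n : int) : xp * (h - n%:~R) = (h - (n - 1)%:~R) * xp.
Proof.
rewrite mulrBr mulrBl xph intrB mulrBl mul1r opprB addrA.
by rewrite intr_comm.
Qed.
Lemma xm_shift (n : int) : (h - n%:~R) * xm = xm * (h - (n - 1)%:~R).
Proof.
by rewrite mulrBr mulrBl xmh intrB mulrBr mulr1 opprB addrA subrK intr_comm.
Qed.

Lemma xp_Hinv n : xp * Hinv K n = Hinv K (n - 1) * xp.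
Proof.
rewrite -[LHS]mul1r -(HinvP (n - 1)).2 -mulrA; congr (_ * _).
by rewrite mulrA -xp_shift -mulrA (HinvP n).1 mulr1.
Qed.

Lemma Uloc_inM (u v : UG K) : Uloc_in (u * v) = Uloc_in u * Uloc_in v.
Proof. exact: loc_inM. Qed.

Lemma Dset_xp d : Dset d ->
  exists2 d', Dset d' & xp * Uloc_in d = Uloc_in d' * xp :> U.
Proof.
elim=> [|{}d n _ [d' Dd' E]].
  by exists 1; [exact: Dset1 | rewrite /Uloc_in loc_in1 mul1r mulr1].
exists (d' * (UG_H K - (n - 1)%:~R)); first exact: DsetM.
by rewrite !Uloc_inM !UG_H_in mulrA E -mulrA xp_shift mulrA.
Qed.

Lemma Dset_xm d : Dset d ->
  exists2 d', Dset d' & Uloc_in d * xm = xm * Uloc_in d' :> U.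
Proof.
elim=> [|{}d n _ [d' Dd' E]].
  by exists 1; [exact: Dset1 | rewrite /Uloc_in loc_in1 mul1r mulr1].
exists (d' * (UG_H K - (n - 1)%:~R)); first exact: DsetM.
by rewrite !Uloc_inM !UG_H_in -mulrA xm_shift mulrA E -mulrA.
Qed.

Lemma loc_inv_xp d : exists d', xp * loc_inv d = loc_inv d' * xp :> U.
Proof.
have [d' Dd' E] := Dset_xp (svalP d); exists (exist (@Dset K) d' Dd').
rewrite -[LHS]mul1r -(loc_mulrV (exist (@Dset K) d' Dd')) -mulrA; congr (_ * _).
by rewrite mulrA -[loc_in _ _ * _]E -mulrA loc_mulVr mulr1.
Qed.

Lemma loc_inv_xm d : exists d', loc_inv d * xm = xm * loc_inv d' :> U.
Proof.
have [d' Dd' E] := Dset_xm (svalP d); exists (exist (@Dset K) d' Dd').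
rewrite -[LHS]mulr1 -(loc_mulVr (exist (@Dset K) d' Dd')) mulrA; congr (_ * _).
by rewrite -mulrA -[xm * _]E mulrA loc_mulrV mul1r.
Qed.

Lemma osp2_decomp (x : osp2 K) :
  x = \sum_b (x.1 b *: ((e b, 0) : osp2 K) + x.2 b *: ((0, e b) : osp2 K)).
Proof.
case: x => u v /=; rewrite (eq_bigr (fun b => (u b *: e b, v b *: e b))); last first.
  move=> b _; rewrite -[LHS]/(u b *: e b + v b *: 0, u b *: 0 + v b *: e b).
  by rewrite !scaler0 addr0 add0r.
have big_pair (F G : osp_basis -> osp K) :
    \sum_b ((F b, G b) : osp2 K) = (\sum_b F b, \sum_b G b).
  by elim/big_rec3: _ => // b x y z _ ->.
rewrite big_pair.
have E (w : osp K) : w = \sum_b w b *: e b.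
  apply/ffunP => b; rewrite sum_ffunE (bigD1 b) //= !ffunE eqxx big1.
    by rewrite addr0 [RHS]mulr1.
  by move=> c cb; rewrite !ffunE eq_sym (negPf cb) [LHS]mulr0.
by rewrite -!E.
Qed.

Section UInd.
Variable P : U -> Prop.
Hypothesis PZ1 : forall a, P (a *: (1 : U)).
Hypothesis PD : forall u v, P u -> P v -> P (u + v).
Hypothesis PM : forall u v, P u -> P v -> P (u * v).
Hypothesis Pl : forall b, P (Uin (e b, 0)).
Hypothesis Pr : forall b, P (Uin (0, e b)).
Hypothesis Pinv : forall d, P (loc_inv d).

Lemma Uloc_ind u : P u.
Proof.
have PZ a v : P v -> P (a *: v).
  by rewrite -[v in _ *: v]mul1r presented_scaleAl; apply: PM.
elim/presented_ind: u => // -[u|d]; last exact: Pinv.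
rewrite -[X in P X]/(Uloc_in u); elim/presented_ind: u => [x|a|u v|u v].
- rewrite -[X in P X]/(Uin x) [x]osp2_decomp Uin_sum.
  elim/big_ind: _ => [||b _]; [|exact: PD|].
    by rewrite -(scale0r (1 : U)).
  by rewrite UinD !UinZ; apply: PD; apply: PZ.
- by rewrite [Uloc_in _]loc_inZ1.
- by rewrite [Uloc_in (u + v)]loc_inD; apply: PD.
- by rewrite [Uloc_in (u * v)]loc_inM; apply: PM.
Qed.
End UInd.

End UlocTheory.

Section Diamond.
Variable K : numFieldType.
Local Notation U := (Uloc K).
Local Notation e b := (osp_e K b).
Local Notation xp := (Xdiag K xp1).
Local Notation xm := (Xdiag K xm1).
Local Notation h := (Hdiag K).

Lemma scale_sign (b : bool) (u : U) : (-1) ^+ b *: u = (-1) ^+ b * u.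
Proof.
by case: b; rewrite ?expr1 ?expr0 ?scaleN1r ?scale1r ?mulN1r ?mul1r.
Qed.

Lemma absorbed_xp (v : U) : absorbed xp v.
Proof.
have scal a : absorbed xp (a *: (1 : U)).
  by apply: absorbed_comm; rewrite /GRing.comm -presented_scaleAr mulr1
    -presented_scaleAl mul1r.
have smul a u : absorbed xp u -> absorbed xp (a *: u : U).
  by rewrite -[u in _ *: u]mul1r presented_scaleAl; apply: absorbedM.
have abs0 : absorbed xp (0 : U) by rewrite -(scale0r (1 : U)).
have stepl b : absorbed xp (Uin (osp_br_basis K xp1 b, 0)) ->
    absorbed xp (Uin (e b, 0)).
  move=> /absorbed_step; apply; rewrite X_lcomm addrC; congr (_ + _).
  exact: scale_sign.
have stepr b : absorbed xp (Uin (0, osp_br_basis K xp1 b)) ->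
    absorbed xp (Uin (0, e b)).
  move=> /absorbed_step; apply; rewrite X_rcomm addrC; congr (_ + _).
  exact: scale_sign.
have Uin00 : Uin (0, 0) = 0 :> U by exact: Uin0.
have UinZl a b : Uin (a *: e b, 0) = a *: Uin (e b, 0) :> U.
  by rewrite -UinZ; congr Uin; rewrite -[RHS]/(_ *: _, _ *: _) scaler0.
have UinZr a b : Uin (0, a *: e b) = a *: Uin (0, e b) :> U.
  by rewrite -UinZ; congr Uin; rewrite -[RHS]/(_ *: _, _ *: _) scaler0.
have l5 : absorbed xp (Uin (e xp2, 0)) by apply: stepl; rewrite Uin00.
have l4 : absorbed xp (Uin (e xp1, 0)).
  by apply: stepl; rewrite UinZl; apply: smul.
have l3 : absorbed xp (Uin (e xh, 0)).
  by apply: stepl; rewrite UinZl; apply: smul.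
have l2 : absorbed xp (Uin (e xm1, 0)) by apply: stepl.
have l1 : absorbed xp (Uin (e xm2, 0)) by apply: stepl.
have r5 : absorbed xp (Uin (0, e xp2)) by apply: stepr; rewrite Uin00.
have r4 : absorbed xp (Uin (0, e xp1)).
  by apply: stepr; rewrite UinZr; apply: smul.
have r3 : absorbed xp (Uin (0, e xh)).
  by apply: stepr; rewrite UinZr; apply: smul.
have r2 : absorbed xp (Uin (0, e xm1)) by apply: stepr.
have r1 : absorbed xp (Uin (0, e xm2)) by apply: stepr.
elim/Uloc_ind: v => //; [exact: absorbedD|exact: absorbedM|by case|by case|].
by apply: absorbed_family; apply: loc_inv_xp.
Qed.

Lemma absorbed_xm (v : U) : absorbed_r xm v.
Proof.
have scal a : absorbed_r xm (a *: (1 : U)).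
  apply: absorbed_r_comm; rewrite /GRing.comm.
  by rewrite -presented_scaleAr mulr1 -presented_scaleAl mul1r.
have smul a (u : U) : absorbed_r xm u -> absorbed_r xm (a *: u : U).
  move=> Au; rewrite (_ : a *: u = (a *: (1 : U)) * u); last first.
    by rewrite -presented_scaleAl mul1r.
  exact: absorbed_rM (scal a) Au.
have abs0 : absorbed_r xm (0 : U) by rewrite -(scale0r (1 : U)).
have step (b : bool) (u f : U) : absorbed_r xm f ->
    xm * u = f + (-1) ^+ b *: (u * xm) -> absorbed_r xm u.
  move=> af E; apply: (@absorbed_r_step _ xm b u (- ((-1) ^+ b *: f))).
    by rewrite -scaleNr; apply: smul.
  rewrite E mulrDr -!scale_sign scalerA -expr2 sqrr_sign scale1r.
  by rewrite addrAC subrr add0r.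
have stepl b : absorbed_r xm (Uin (osp_br_basis K xm1 b, 0)) ->
    absorbed_r xm (Uin (e b, 0)).
  by move=> /step; apply; apply: X_lcomm.
have stepr b : absorbed_r xm (Uin (0, osp_br_basis K xm1 b)) ->
    absorbed_r xm (Uin (0, e b)).
  by move=> /step; apply; apply: X_rcomm.
have Uin00 : Uin (0, 0) = 0 :> U by exact: Uin0.
have UinZl a b : Uin (a *: e b, 0) = a *: Uin (e b, 0) :> U.
  by rewrite -UinZ; congr Uin; rewrite -[RHS]/(_ *: _, _ *: _) scaler0.
have UinZr a b : Uin (0, a *: e b) = a *: Uin (0, e b) :> U.
  by rewrite -UinZ; congr Uin; rewrite -[RHS]/(_ *: _, _ *: _) scaler0.
have l1 : absorbed_r xm (Uin (e xm2, 0)) by apply: stepl; rewrite Uin00.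
have l2 : absorbed_r xm (Uin (e xm1, 0)).
  by apply: stepl; rewrite UinZl; apply: smul.
have l3 : absorbed_r xm (Uin (e xh, 0)).
  by apply: stepl; rewrite UinZl; apply: smul.
have l4 : absorbed_r xm (Uin (e xp1, 0)) by apply: stepl.
have l5 : absorbed_r xm (Uin (e xp2, 0)) by apply: stepl.
have r1 : absorbed_r xm (Uin (0, e xm2)) by apply: stepr; rewrite Uin00.
have r2 : absorbed_r xm (Uin (0, e xm1)).
  by apply: stepr; rewrite UinZr; apply: smul.
have r3 : absorbed_r xm (Uin (0, e xh)).
  by apply: stepr; rewrite UinZr; apply: smul.
have r4 : absorbed_r xm (Uin (0, e xp1)) by apply: stepr.
have r5 : absorbed_r xm (Uin (0, e xp2)) by apply: stepr.
elim/Uloc_ind: v => //; [exact: absorbed_rD|exact: absorbed_rM|by case|by case|].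
by apply: absorbed_r_family; apply: loc_inv_xm.
Qed.

Lemma xp_exp_absorb (v : U) :
  exists N, forall n, (N <= n)%N -> exists y, xp ^+ n * v = y * xp.
Proof. exact: (absorbed_xp v 1%N). Qed.

Lemma xm_exp_absorb (v : U) :
  exists N, forall n, (N <= n)%N -> exists y, v * xm ^+ n = xm * y.
Proof.
exact: (absorbed_xm v 1%N).
Qed.

Lemma Hinv_comm (n : int) : GRing.comm (Hinv K n) h.
Proof.
have [E1 E2] := HinvP K n; rewrite /GRing.comm.
have E : (h - n%:~R) * h = h * (h - n%:~R) by rewrite mulrBr mulrBl intr_comm.
rewrite -[RHS]mul1r -E2 -mulrA [(h - _) * _]mulrA E -!mulrA E1.
by rewrite mulr1.
Qed.

Lemma comm_sub_int (u : U) (n : int) :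
  GRing.comm u h -> GRing.comm u (h - n%:~R).
Proof. by move=> uh; rewrite /GRing.comm mulrBr mulrBl uh intr_comm. Qed.

Definition shifted_phi : nat -> U := fix f n :=
  if n is n'.+1 then
    if odd n then - Hinv K ((uphalf n)%:Z - 1) * f n'
    else ((uphalf n)%:R^-1 : K) *: f n'
  else 1.

Lemma phi_h n : GRing.comm (dra_phi K n) h.
Proof.
elim: n => [|n IHn]; first by rewrite /GRing.comm /= mul1r mulr1.
rewrite [dra_phi _ _]/=; case: ifP => _.
  by apply/commr_sym/commrM; [apply/commrN/commr_sym/Hinv_comm|exact/commr_sym].
by rewrite /GRing.comm -presented_scaleAl IHn presented_scaleAr.
Qed.

Lemma shifted_phi_h n : GRing.comm (shifted_phi n) h.
Proof.
elim: n => [|n IHn]; first by rewrite /GRing.comm /= mul1r mulr1.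
rewrite [shifted_phi _]/=; case: ifP => _.
  by apply/commr_sym/commrM; [apply/commrN/commr_sym/Hinv_comm|exact/commr_sym].
by rewrite /GRing.comm -presented_scaleAl IHn presented_scaleAr.
Qed.

Lemma xp_phi n : xp * dra_phi K n = shifted_phi n * xp.
Proof.
elim: n => [|n IHn]; first by rewrite /= mul1r mulr1.
rewrite [dra_phi _ _]/= [shifted_phi _]/=; case: ifP => _.
  by rewrite mulrA mulrN xp_Hinv -mulNr -mulrA IHn mulrA.
by rewrite -presented_scaleAr IHn presented_scaleAl.
Qed.

Lemma uphalf_doubleS m : uphalf m.*2.+1 = m.+1.
Proof. by rewrite /= doubleK. Qed.

Lemma phi_odd m : dra_phi K m.*2.+1 * (h - m.+1%:R) = - dra_phi K m.*2.
Proof.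
rewrite [dra_phi K m.*2.+1]/= odd_double doubleK -mulrA.
rewrite (_ : m.+1%:R = (m.+1%:Z)%:~R) // (comm_sub_int _ (phi_h _)).
by rewrite mulrA mulNr (HinvP K m.+1).2 mulN1r.
Qed.

Lemma phi_even m : dra_phi K m.+1.*2 *+ m.+1 = dra_phi K m.*2.+1.
Proof.
rewrite -scaler_nat doubleS [dra_phi K m.*2.+2]/= odd_double /= uphalf_double.
by rewrite scalerA mulfV ?pnatr_eq0 // scale1r odd_double.
Qed.

Lemma shifted_phi_odd m :
  shifted_phi m.*2.+1 * (h - m%:R) = - shifted_phi m.*2.
Proof.
rewrite [shifted_phi m.*2.+1]/= odd_double doubleK -mulrA.
rewrite (_ : m%:R = (m.+1%:Z - 1)%:~R); last by rewrite -predn_int.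
rewrite (comm_sub_int _ (shifted_phi_h _)).
by rewrite mulrA mulNr (HinvP K (m.+1%:Z - 1)).2 mulN1r.
Qed.

Lemma shifted_phi_even m : shifted_phi m.+1.*2 *+ m.+1 = shifted_phi m.*2.+1.
Proof.
rewrite -scaler_nat doubleS [shifted_phi m.*2.+2]/= odd_double /= uphalf_double.
by rewrite scalerA mulfV ?pnatr_eq0 // scale1r odd_double.
Qed.

Definition Jpred : {pred U} := fun u => `[< inJ u >].

Fact Jpred_zmod_closed : zmod_closed Jpred.
Proof.
by split=> [|u v /asboolP Ju /asboolP Jv]; apply/asboolP; [exact: inJ0|exact: inJB].
Qed.
HB.instance Definition _ := GRing.isZmodClosed.Build U Jpred Jpred_zmod_closed.

(* U / J, a module; its ring structure, defined below, is the diamond product *)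
Definition dra := Quotient.quot (Jpred : zmodClosed U).
HB.instance Definition _ := Choice.on dra.
HB.instance Definition _ := GRing.Zmodule.on dra.

Definition dra_pi (u : U) : dra := \pi_(Quotient.quot (Jpred : zmodClosed U)) u.

Lemma dra_pi_repr (a : dra) : dra_pi (repr a) = a.
Proof. exact: reprK. Qed.

Lemma dra_piP u v : dra_pi u = dra_pi v <-> inJ (u - v).
Proof.
split=> [/eqP|Juv].
  rewrite -[_ == _]/(_ == _ %[mod Quotient.quot _]) -Quotient.idealrBE.
  by move/asboolP.
apply/eqP; rewrite -[_ == _]/(_ == _ %[mod Quotient.quot (Jpred : zmodClosed U)]).
by rewrite -Quotient.idealrBE; apply/asboolP.
Qed.

Lemma dra_piD : {morph dra_pi : u v / u + v}.
Proof. by move=> u v; rewrite /dra_pi Quotient.pi_add. Qed.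

Lemma dra_pi0 : dra_pi 0 = 0.
Proof. by apply: (addrI (dra_pi 0)); rewrite -dra_piD !addr0. Qed.

Lemma dra_pi_eq0 u : inJ u -> dra_pi u = 0.
Proof. by move=> Ju; rewrite -dra_pi0; apply/dra_piP; rewrite subr0. Qed.

Definition dra_scale (a : K) (x : dra) : dra := dra_pi (a *: repr x).

Lemma dra_piZ a u : dra_pi (a *: u) = dra_scale a (dra_pi u).
Proof.
apply/dra_piP; rewrite -scalerBr; apply/inJZ/dra_piP.
by rewrite dra_pi_repr.
Qed.

Lemma dra_pi_ind (P : dra -> Prop) : (forall u, P (dra_pi u)) -> forall a, P a.
Proof. by move=> Pu a; rewrite -[a]dra_pi_repr. Qed.

Fact dra_scaleA a b x : dra_scale a (dra_scale b x) = dra_scale (a * b) x.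
Proof. by elim/dra_pi_ind: x => u; rewrite -!dra_piZ scalerA. Qed.
Fact dra_scale1 : left_id 1 dra_scale.
Proof. by elim/dra_pi_ind => u; rewrite -dra_piZ scale1r. Qed.
Fact dra_scaleDr : right_distributive dra_scale +%R.
Proof.
by move=> a; elim/dra_pi_ind => u; elim/dra_pi_ind => v;
  rewrite -!(dra_piD, dra_piZ) scalerDr.
Qed.
Fact dra_scaleDl x : {morph dra_scale^~ x : a b / a + b}.
Proof.
by move=> a b; elim/dra_pi_ind: x => u; rewrite -!(dra_piZ, dra_piD) scalerDl.
Qed.
HB.instance Definition _ := GRing.Zmodule_isLmodule.Build K dra
  dra_scaleA dra_scale1 dra_scaleDr dra_scaleDl.

(* The summands of the diamond product of u + J and v + J; all but finitely many
   of them vanish in U / J, and [\sum_(n \in _)] sums over the finite support. *)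
Definition diamond_term (u v : U) (n : nat) : U :=
  u * dra_phi K n * xm ^+ n * xp ^+ n * v.

Definition diamond_rep (u v : U) : dra :=
  \sum_(n \in [set: nat]) dra_pi (diamond_term u v n).

Definition diamond (a b : dra) : dra := diamond_rep (repr a) (repr b).

Lemma phi_xm n : exists f, dra_phi K n * xm ^+ n = xm ^+ n * f.
Proof.
suff H m k : exists f, dra_phi K k * xm ^+ m = xm ^+ m * f by exact: H.
elim: k => [|k [f E]]; first by exists 1; rewrite mul1r mulr1.
rewrite [dra_phi _ _]/=; case: ifP => _; last first.
  by exists ((uphalf k.+1)%:R^-1 *: f); rewrite -presented_scaleAl E presented_scaleAr.
set d := Hinv _ _.
have [d' E'] : exists d', d * xm ^+ m = xm ^+ m * d'.
  suff : forall c, exists c' : {d : UG K | Dset d},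
      loc_inv c * xm ^+ m = xm ^+ m * loc_inv c' :> U.
    by move=> /(_ (exist _ _ (Dset_gen K (uphalf k.+1)%:Z)))[c' Ec]; exists (loc_inv c').
  elim: m {E} => [|m IHm] c; first by exists c; rewrite mul1r mulr1.
  have [c' E1] := loc_inv_xm c; have [c'' E2] := IHm c'.
  by exists c''; rewrite exprS mulrA E1 -[LHS]mulrA E2 !mulrA.
by exists (- d' * f); rewrite -mulrA E mulrA !mulNr E' mulrN mulrA.
Qed.

Lemma xm_phi_absorb (u : U) :
  exists N, forall n, (N <= n)%N -> exists y, u * dra_phi K n * xm ^+ n = xm * y.
Proof.
have [N hN] := xm_exp_absorb u; exists N => n /hN[y E].
have [f fE] := phi_xm n; exists (y * f).
by rewrite -mulrA fE mulrA E mulrA.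
Qed.

Lemma diamond_repE u v N :
  (forall n, (N <= n)%N -> inJ (diamond_term u v n)) ->
  diamond_rep u v = dra_pi (\sum_(n < N) diamond_term u v n).
Proof.
move=> hN; rewrite (big_morph dra_pi dra_piD dra_pi0).
rewrite (fsbig_ord +%R N (fun n => dra_pi (diamond_term u v n))).
apply/esym/fsbig_widen => // n [_ /negP]; rewrite -leqNgt => Nn.
exact/dra_pi_eq0/hN.
Qed.

Lemma diamond_term_l u :
  exists N, forall v n, (N <= n)%N -> inJ (diamond_term u v n).
Proof.
have [N hN] := xm_phi_absorb u; exists N => v n /hN[y E].
by rewrite /diamond_term E -!mulrA; apply: inJ_l.
Qed.

Lemma diamond_term_r v :
  exists N, forall u n, (N <= n)%N -> inJ (diamond_term u v n).
Proof.
have [N hN] := xp_exp_absorb v; exists N => u n /hN[y E].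
by rewrite /diamond_term -[_ * _ * v]mulrA E mulrA; apply: inJ_r.
Qed.

Lemma diamond_repDl u u' v :
  diamond_rep (u + u') v = diamond_rep u v + diamond_rep u' v.
Proof.
have [N hN] := diamond_term_r v.
rewrite !(@diamond_repE _ _ N) => // [|n|n|n]; try exact: hN.
rewrite -dra_piD -big_split; congr dra_pi; apply: eq_bigr => n _.
by rewrite /diamond_term !mulrDl.
Qed.

Lemma diamond_repDr u v v' :
  diamond_rep u (v + v') = diamond_rep u v + diamond_rep u v'.
Proof.
have [N hN] := diamond_term_l u.
rewrite !(@diamond_repE _ _ N) => // [|n|n|n]; try exact: hN.
rewrite -dra_piD -big_split; congr dra_pi; apply: eq_bigr => n _.
by rewrite /diamond_term !mulrDr.
Qed.

Lemma diamond_rep_xm u y : diamond_rep u (xm * y) = 0.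
Proof.
have [N hN] := diamond_term_l u; have [M hM] := xp_exp_absorb y.
set m := maxn N M.
rewrite (@diamond_repE _ _ m.+1) => [|n Hn]; last first.
  by apply: hN; rewrite (leq_trans _ (ltnW Hn)) // leq_maxl.
apply: dra_pi_eq0.
have -> : \sum_(n < m.+1) diamond_term u (xm * y) n =
    u * (\sum_(n < m.+1) dra_phi K n * xm ^+ n * xp ^+ n * xm) * y.
  by rewrite mulr_sumr mulr_suml; apply: eq_bigr => n _; rewrite /diamond_term !mulrA.
rewrite (telescope_xm (xpm K) (xph K) (xmh K) phi_odd phi_even).
have [z zE] := hM m (leq_maxr _ _).
by rewrite -!mulrA zE !mulrA; apply: inJ_r.
Qed.

Lemma diamond_rep_xp y v : diamond_rep (y * xp) v = 0.
Proof.
have [N hN] := diamond_term_l (y * xp); have [M hM] := xp_exp_absorb v.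
set m := maxn N M.
rewrite (@diamond_repE _ _ m.+1) => [|n Hn]; last first.
  by apply: hN; rewrite (leq_trans _ (ltnW Hn)) // leq_maxl.
apply: dra_pi_eq0.
have -> : \sum_(n < m.+1) diamond_term (y * xp) v n =
    y * (\sum_(n < m.+1) shifted_phi n * xp * xm ^+ n * xp ^+ n) * v.
  rewrite mulr_sumr mulr_suml; apply: eq_bigr => n _.
  by rewrite /diamond_term -xp_phi !mulrA.
rewrite (telescope_xp (xpm K) (xmh K) shifted_phi_odd shifted_phi_even).
have [z zE] := hM m.+1 (leqW (leq_maxr _ _)).
by rewrite -!mulrA zE !mulrA; apply: inJ_r.
Qed.

Lemma diamond_rep_Jl u v : inJ u -> diamond_rep u v = 0.
Proof.
move=> /inJP[a [b ->]]; rewrite diamond_repDl diamond_rep_xp addr0.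
have [N hN] := diamond_term_l (xm * a).
rewrite (diamond_repE (hN v)); apply: dra_pi_eq0.
by rewrite /diamond_term; under eq_bigr do rewrite -!mulrA;
   rewrite -mulr_sumr; apply: inJ_l.
Qed.

Lemma diamond_rep_Jr u v : inJ v -> diamond_rep u v = 0.
Proof.
move=> /inJP[a [b ->]]; rewrite diamond_repDr diamond_rep_xm add0r.
have [N hN] := diamond_term_l u.
rewrite (diamond_repE (hN _)); apply: dra_pi_eq0.
by rewrite /diamond_term; under eq_bigr do rewrite mulrA;
   rewrite -mulr_suml; apply: inJ_r.
Qed.

Lemma diamondE u v : diamond (dra_pi u) (dra_pi v) = diamond_rep u v.
Proof.
rewrite /diamond; set u' := repr _; set v' := repr _.
have Ju : inJ (u - u') by apply/dra_piP; rewrite dra_pi_repr.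
have Jv : inJ (v - v') by apply/dra_piP; rewrite dra_pi_repr.
rewrite -[u in RHS](subrK u') -[v in RHS](subrK v').
by rewrite diamond_repDl (diamond_rep_Jl _ Ju) add0r diamond_repDr (diamond_rep_Jr _ Jv) add0r.
Qed.

Fact diamondA : associative diamond.
Proof.
elim/dra_pi_ind => u; elim/dra_pi_ind => v; elim/dra_pi_ind => w.
have [N hN] := diamond_term_l u; have [M hM] := diamond_term_r w.
rewrite !diamondE (diamond_repE (fun n => hM v n)) (diamond_repE (fun n => hN v n)).
rewrite !diamondE (diamond_repE (fun n => hN _ n)) (diamond_repE (fun n => hM _ n)).
congr dra_pi.
have -> : \sum_(n < N) diamond_term u (\sum_(m < M) diamond_term v w m) n =
    \sum_(n < N) \sum_(m < M) diamond_term u (diamond_term v w m) n.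
  by apply: eq_bigr => n _; rewrite /diamond_term mulr_sumr.
rewrite exchange_big; apply: eq_bigr => m _.
rewrite /diamond_term !mulr_suml; apply: eq_bigr => n _.
by rewrite !mulrA.
Qed.

Fact diamond_1l : left_id (dra_pi 1) diamond.
Proof.
elim/dra_pi_ind => v; rewrite diamondE (@diamond_repE _ _ 1%N) => [|[//|n] _].
  by rewrite big_ord1 /diamond_term !mulr1 mul1r.
have [f E] := phi_xm n.+1.
by rewrite /diamond_term mul1r E exprS -!mulrA; apply: inJ_l.
Qed.

Fact diamond_1r : right_id (dra_pi 1) diamond.
Proof.
elim/dra_pi_ind => v; rewrite diamondE (@diamond_repE _ _ 1%N) => [|[//|n] _].
  by rewrite big_ord1 /diamond_term !mulr1.
by rewrite /diamond_term mulr1 [xp ^+ _]exprSr mulrA; apply: inJ_r.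
Qed.

Fact diamondDl : left_distributive diamond +%R.
Proof.
by elim/dra_pi_ind => u; elim/dra_pi_ind => v; elim/dra_pi_ind => w;
  rewrite -dra_piD !diamondE diamond_repDl.
Qed.
Fact diamondDr : right_distributive diamond +%R.
Proof.
by elim/dra_pi_ind => u; elim/dra_pi_ind => v; elim/dra_pi_ind => w;
  rewrite -dra_piD !diamondE diamond_repDr.
Qed.

HB.instance Definition _ := GRing.Zmodule_isPzRing.Build dra
  diamondA diamond_1l diamond_1r diamondDl diamondDr.

End Diamond.

Section DraTheory.
Variable K : numFieldType.
Local Notation A := (dra K).

Lemma dra_mulE (u v : Uloc K) : dra_pi u * dra_pi v = diamond_rep u v.
Proof. exact: diamondE. Qed.

Lemma dra_scalerAl (a : K) (x y : A) : a *: (x * y) = (a *: x) * y.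
Proof.
elim/dra_pi_ind: x => u; elim/dra_pi_ind: y => v.
have [N hN] := diamond_term_r v.
rewrite -[a *: dra_pi u]dra_piZ !dra_mulE !(diamond_repE (hN _)) -[LHS]dra_piZ.
congr dra_pi; rewrite scaler_sumr; apply: eq_bigr => n _.
by rewrite /diamond_term !presented_scaleAl.
Qed.

Lemma dra_scalerAr (a : K) (x y : A) : a *: (x * y) = x * (a *: y).
Proof.
elim/dra_pi_ind: x => u; elim/dra_pi_ind: y => v.
have [N hN] := diamond_term_l u.
rewrite -[a *: dra_pi v]dra_piZ !dra_mulE !(diamond_repE (hN _)) -[LHS]dra_piZ.
congr dra_pi; rewrite scaler_sumr; apply: eq_bigr => n _.
by rewrite /diamond_term !presented_scaleAr.
Qed.

Definition xbar (b : osp_basis) : A := dra_pi (Xtilde K b).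
Definition Hbar : A := dra_pi (Hdiag K).

(* K-algebra automorphisms of (U / J, diamond) *)
Record dra_aut := DraAut {
  dra_fun :> A -> A;
  dra_aut_linear : linear dra_fun;
  dra_aut_monoid : GRing.monoid_morphism dra_fun;
  dra_aut_bij : bijective dra_fun
}.
HB.instance Definition _ := gen_eqMixin dra_aut.
HB.instance Definition _ := gen_choiceMixin dra_aut.

Lemma dra_aut_eq (s t : dra_aut) : s =1 t -> s = t.
Proof.
case: s t => s s1 s2 s3 [t t1 t2 t3] /= /funext st.
by case: _ / st in t1 t2 t3 *; congr DraAut; apply: Prop_irrelevance.
Qed.

Fact dra_id_monoid : GRing.monoid_morphism (@id A). Proof. by []. Qed.
Fact dra_id_bij : bijective (@id A). Proof. by exists id. Qed.
Definition dra_id : dra_aut :=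
  @DraAut id (fun _ _ _ => erefl) dra_id_monoid dra_id_bij.

Section Comp.
Variables s t : dra_aut.
Fact dra_comp_linear : linear (s \o t).
Proof. by move=> a u v; rewrite /= !dra_aut_linear. Qed.
Fact dra_comp_monoid : GRing.monoid_morphism (s \o t).
Proof.
have [[s1 sM] [t1 tM]] := (dra_aut_monoid s, dra_aut_monoid t).
by split=> [|u v]; rewrite /= ?t1 ?s1 // tM sM.
Qed.
Definition dra_comp : dra_aut :=
  DraAut dra_comp_linear dra_comp_monoid
    (bij_comp (dra_aut_bij s) (dra_aut_bij t)).
End Comp.

Section Inv.
Variable s : dra_aut.
Fact dra_inv_ex : exists t : A -> A, cancel s t /\ cancel t s.
Proof. by have [t st ts] := dra_aut_bij s; exists t. Qed.
Definition dra_inv_fun : A -> A := projT1 (cid dra_inv_ex).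
Fact dra_invK : cancel s dra_inv_fun.
Proof. exact: (projT2 (cid dra_inv_ex)).1. Qed.
Fact dra_invKV : cancel dra_inv_fun s.
Proof. exact: (projT2 (cid dra_inv_ex)).2. Qed.
Fact dra_inv_linear : linear dra_inv_fun.
Proof.
by move=> a u v; apply: (can_inj dra_invK); rewrite dra_aut_linear !dra_invKV.
Qed.
Fact dra_inv_monoid : GRing.monoid_morphism dra_inv_fun.
Proof.
have [s1 sM] := dra_aut_monoid s.
by split=> [|u v]; apply: (can_inj dra_invK); rewrite ?sM !dra_invKV ?s1.
Qed.
Fact dra_inv_bij : bijective dra_inv_fun.
Proof. by exists s; [exact: dra_invKV | exact: dra_invK]. Qed.
Definition dra_inv : dra_aut := DraAut dra_inv_linear dra_inv_monoid dra_inv_bij.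
End Inv.

Fact dra_compA : associative dra_comp.
Proof. by move=> s t u; apply: dra_aut_eq. Qed.
Fact dra_comp1s : left_id dra_id dra_comp.
Proof. by move=> s; apply: dra_aut_eq. Qed.
Fact dra_comps1 : right_id dra_id dra_comp.
Proof. by move=> s; apply: dra_aut_eq. Qed.
Fact dra_compVs : left_inverse dra_id dra_inv dra_comp.
Proof. by move=> s; apply: dra_aut_eq => x; apply: dra_invK. Qed.
Fact dra_compsV : right_inverse dra_id dra_inv dra_comp.
Proof. by move=> s; apply: dra_aut_eq => x; apply: dra_invKV. Qed.
HB.instance Definition _ := isGroup.Build dra_aut
  dra_compA dra_comp1s dra_comps1 dra_compVs dra_compsV.

Lemma dra_aut_scale (s : dra_aut) (a : K) x : s (a *: x) = a *: s x.
Proof.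
have s0 : s 0 = 0.
  have := dra_aut_linear s (-1) 0 0.
  by rewrite scaler0 addr0 scaleN1r addNr.
by rewrite -[_ *: x]addr0 dra_aut_linear s0 addr0.
Qed.

(* tau multiplies each generator xbar b by the scalar k b and fixes H *)
Definition rescales (tau : dra_aut) (k : osp_basis -> K) : Prop :=
  (forall b, tau (xbar b) = k b *: xbar b) /\ tau Hbar = Hbar.

Definition is_rescaling : {pred dra_aut} :=
  fun tau => `[< exists k, rescales tau k >].

Fact is_rescaling_closed : group_closed is_rescaling.
Proof.
split=> [|s t /asboolP[k [sk sH]] /asboolP[l [tl tH]]]; apply/asboolP.
  by exists (fun=> 1); split=> // b; rewrite scale1r.
exists (fun b => (l b)^-1 * k b); split=> [b|].
  have -> : (s / t)%g (xbar b) = s ((l b)^-1 *: xbar b).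
    rewrite -[LHS]/(s (dra_inv t (xbar b))); congr (s _).
    apply: (can_inj (dra_invK t)); rewrite [LHS]dra_invKV dra_aut_scale tl.
    have [l0|l0] := eqVneq (l b) 0; last by rewrite scalerA mulVf ?scale1r.
    apply: (can_inj (dra_invK t)).
    by rewrite tl l0 invr0 dra_aut_scale !scale0r.
  by rewrite dra_aut_scale sk scalerA.
rewrite -[LHS]/(s (dra_inv t Hbar)) -[X in dra_inv t X]tH.
by rewrite [dra_inv t _]dra_invK.
Qed.

(* the automorphisms that rescale the generators, as a subgroup of [dra_aut] *)
Definition rescaling_group := {tau : dra_aut | is_rescaling tau}.
HB.instance Definition _ := [Choice of rescaling_group by <:].
HB.instance Definition _ := SubType.on rescaling_group.
HB.instance Definition _ :=
  SubChoice_isSubGroup.Build dra_aut is_rescaling rescaling_group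
    is_rescaling_closed.

End DraTheory.

(* the multiplicative group of a field *)
Section UnitGroup.
Variable F : fieldType.
Definition unit_group := {x : F | x != 0}.
HB.instance Definition _ := SubType.on unit_group.
HB.instance Definition _ := Choice.on unit_group.
Definition unit_mk (x : F) (x0 : x != 0) : unit_group := exist _ x x0.
Definition unit_one : unit_group := unit_mk (oner_neq0 F).
Definition unit_mul (u v : unit_group) : unit_group :=
  unit_mk (mulf_neq0 (valP u) (valP v)).
Fact unit_inv_neq0 (u : unit_group) : (val u)^-1 != 0.
Proof. by rewrite invr_eq0; exact: (valP u). Qed.
Definition unit_inv (u : unit_group) : unit_group := unit_mk (unit_inv_neq0 u).

Fact unit_mulA : associative unit_mul.
Proof. by move=> u v w; apply: val_inj; apply: mulrA. Qed.
Fact unit_mul1 : left_id unit_one unit_mul.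
Proof. by move=> u; apply: val_inj; apply: mul1r. Qed.
Fact unit_mulr1 : right_id unit_one unit_mul.
Proof. by move=> u; apply: val_inj; apply: mulr1. Qed.
Fact unit_mulV : left_inverse unit_one unit_inv unit_mul.
Proof. by move=> u; apply: val_inj; apply: mulVf (valP u). Qed.
Fact unit_mulrV : right_inverse unit_one unit_inv unit_mul.
Proof. by move=> u; apply: val_inj; apply: mulfV (valP u). Qed.
HB.instance Definition _ := isGroup.Build unit_group
  unit_mulA unit_mul1 unit_mulr1 unit_mulV unit_mulrV.
End UnitGroup.

(* Main.v *)
Require Import Defs.
From HB Require Import structures.
From mathcomp Require Import all_boot all_order all_algebra.
From mathcomp Require Import boolp functions reals complex ssrAC ring.

Set Implicit Arguments.
Unset Strict Implicit.
Unset Printing Implicit Defensive.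
Import Order.TTheory GRing.Theory Num.Theory.
Local Open Scope ring_scope.
Local Open Scope quotient_scope.

(* Exchanging the two factors of G and rescaling root vectors by the torus extend
   to automorphisms of U that preserve J and the phi_n, hence to the asserted
   automorphisms of U / J; they are all of them because U / J is generated by the
   xbar b and D^-1 U(h).

   The constraints on the scalars come from three relations of the reduction
   algebra,
     H xa xa = 2 h x2a,   x-a x-a H = - 2 x-2a h,
     H xa x-a = H H - h h  modulo the left ideal generated by xa and x2a.
   The sides of the first two are nonzero, and in the third H H and h h are independent modulo
   that left ideal: both are seen by letting U act on a tensor product of two Verma
   modules and taking functionals that kill the image of X_-a. *)

(** [U] is known only by generators and relations, with no basis at hand. Both halves of the
    argument therefore go through modules: a map out of [U] is built as an action, and an element is
    shown to lie outside [J] by evaluating it on a vector. An action of the Lie superalgebra extends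
    to [U] only when every [H - n] acts bijectively, so the highest weights [a], [b] of the two
    Verma modules must satisfy: [a + b] is not an integer. This is where the fractions 1/4 and 3/4
    come from. The product of [U / J] differs from that of [U] by correction terms. In the first two
    relations those of index at least 2 vanish in [U / J]. In the third they are not computed: the
    left ideal absorbs them, and since a rescaling maps this ideal to itself, coefficients can still
    be compared modulo it. The same corrections make generation delicate. Instead of a filtration by
    degree, the proof uses a set of elements stable under the Borel part, and an induction on weight
    from [-2 alpha] upwards. *)

(** * Actions of presented algebras and of the localized enveloping algebra *)

Section PresentedAction.
Variables (K : fieldType) (X : Type) (r : ncterm K X -> ncterm K X -> Prop).
Variable V : lmodType K.

Definition is_action (act : presented r -> V -> V) : Prop :=
  [/\ forall u, linear (act u),
      forall a v, act (a *: (1 : presented r)) v = a *: v,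
      forall u u' v, act (u + u') v = act u v + act u' v
    & forall u u' v, act (u * u') v = act u (act u' v)].

Variable g : X -> V -> V.

Fixpoint nc_act (t : ncterm K X) (v : V) : V :=
  match t with
  | NCvar x => g x v
  | NCconst a => a *: v
  | NCadd s t => nc_act s v + nc_act t v
  | NCmul s t => nc_act s (nc_act t v)
  end.

Hypothesis g_lin : forall x, linear (g x).
Hypothesis g_rel : forall s t, r s t -> nc_act s =1 nc_act t.

Lemma nc_act_linear t : linear (nc_act t).
Proof.
elim: t => [x|a|s IHs t IHt|s IHs t IHt] /= b u v; first exact: g_lin.
- by rewrite scalerDr !scalerA mulrC.
- by rewrite IHs IHt scalerDr addrACA.
- by rewrite IHt IHs.
Qed.

Lemma nc_act_scale t b v : nc_act t (b *: v) = b *: nc_act t v.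
Proof.
have t0 : nc_act t 0 = 0.
  by have := nc_act_linear t (-1) 0 0; rewrite scaler0 addr0 scaleN1r addNr.
by rewrite -[_ *: v]addr0 nc_act_linear t0 addr0.
Qed.

Lemma nc_act_add t u v : nc_act t (u + v) = nc_act t u + nc_act t v.
Proof. by rewrite -[u in LHS]scale1r nc_act_linear scale1r. Qed.

Lemma nc_act_cong s t : nccong r s t -> nc_act s =1 nc_act t.
Proof.
elim=> {s t}.
- exact: g_rel.
- by [].
- by move=> s t _ IH v; rewrite IH.
- by move=> s t u _ IH1 _ IH2 v; rewrite IH1 IH2.
- by move=> s s' t t' _ IH1 _ IH2 v /=; rewrite IH1 IH2.
- by move=> s s' t t' _ IH1 _ IH2 v /=; rewrite IH2 IH1.
- by move=> s t u v /=; rewrite addrA.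
- by move=> s t v /=; rewrite addrC.
- by move=> s v /=; rewrite scale0r add0r.
- by move=> s v /=; rewrite scaleN1r addNr scale0r.
- by [].
- by move=> s v /=; rewrite scale1r.
- by [].
- by move=> s t u v /=; rewrite nc_act_add.
- by move=> a b v /=; rewrite scalerDl.
- by move=> a b v /=; rewrite scalerA.
- by move=> a s v /=; rewrite nc_act_scale.
Qed.

(** The universal property in module form. Algebra maps out of the presented algebra are also
    obtained from it, by acting on the target through left multiplication. *)
Lemma presented_action : exists2 act,
  is_action act & forall x, act (presented_gen r x) =1 g x.
Proof.
pose act u v := nc_act (repr (u : presented r)) v.
have actE t : act (\pi_(presented r) t) =1 nc_act t.
  exact/nc_act_cong/nccong_repr.
exists act => [|x v]; last exact: (actE (NCvar K x)).
split=> [u|a v|u u' v|u u' v]; first exact: nc_act_linear.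
- by rewrite -pi_ncconst actE.
- rewrite -[u]reprK -[u']reprK -[X in act X]pi_ncadd.
  by rewrite !actE.
- rewrite -[u]reprK -[u']reprK -[X in act X]pi_ncmul.
  by rewrite !actE.
Qed.

End PresentedAction.

Section ActionTheory.
Variables (K : fieldType) (X : Type) (r : ncterm K X -> ncterm K X -> Prop).
Variables (V : lmodType K) (act : presented r -> V -> V).
Hypothesis actP : is_action act.

Lemma act_lin u a v w : act u (a *: v + w) = a *: act u v + act u w.
Proof. by case: actP => H _ _ _; apply: H. Qed.
Lemma act0 u : act u 0 = 0.
Proof.
by have := act_lin u (-1) 0 0; rewrite scaler0 addr0 scaleN1r addNr.
Qed.
Lemma act_scale u a v : act u (a *: v) = a *: act u v.
Proof. by rewrite -[_ *: v]addr0 act_lin act0 addr0. Qed.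
Lemma actZ1 a v : act (a *: (1 : presented r)) v = a *: v.
Proof. by case: actP. Qed.
Lemma actD u u' v : act (u + u') v = act u v + act u' v.
Proof. by case: actP. Qed.
Lemma actM u u' v : act (u * u') v = act u (act u' v).
Proof. by case: actP. Qed.
Lemma act1 v : act 1 v = v.
Proof. by rewrite -[1]scale1r actZ1 scale1r. Qed.
Lemma actZ a u v : act (a *: u) v = a *: act u v.
Proof. by rewrite -[u in LHS]mul1r presented_scaleAl actM actZ1. Qed.
Lemma actN u v : act (- u) v = - act u v.
Proof. by rewrite -scaleN1r actZ scaleN1r. Qed.
Lemma actB u u' v : act (u - u') v = act u v - act u' v.
Proof. by rewrite actD actN. Qed.
Lemma act_int (n : int) v : act n%:~R v = n%:~R *: v.
Proof.
rewrite (_ : n%:~R = (n%:~R : K) *: (1 : presented r)); first exact: actZ1.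
by rewrite scaler_int.
Qed.
End ActionTheory.

Section UlocAction.
Variables (K : numFieldType) (V : lmodType K).
Local Notation e b := (osp_e K b).
Variable rho : osp2 K -> V -> V.
Hypothesis rho_lin : forall x, linear (rho x).
Hypothesis rho_linl : forall a x y v, rho (a *: x + y) v = a *: rho x v + rho y v.
Hypothesis rho_br : forall p q x y v, osp2_homog p x -> osp2_homog q y ->
  rho x (rho y v) = rho (osp2_br x y) v + (-1) ^+ (p && q) *: rho y (rho x v).
Hypothesis rho_H : forall n : int,
  bijective (fun v => rho (e xh, e xh) v - n%:~R *: v).

Lemma UG_action : exists2 act : UG K -> V -> V,
  is_action act & forall x, act (UG_in x) =1 rho x.
Proof.
apply: presented_action => // s t [a x y|p q x y hx hy] v /=.
  exact: rho_linl.
exact: rho_br.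
Qed.

(** Bijectivity of the [H - n] passes to their products, hence to all of [Dset]; formal inverses
    then act by inverse maps, whose linearity is automatic. *)
Lemma Uloc_action : exists2 act : Uloc K -> V -> V,
  is_action act & forall x, act (Uin x) =1 rho x.
Proof.
have [act actP actE] := UG_action.
have Dbij d : Dset d -> bijective (act d).
  elim=> [|{}d n _ IH]; first by exists id => v; rewrite !(act1 actP).
  have -> : act (d * (UG_H K - n%:~R)) =
      act d \o (fun v => rho (e xh, e xh) v - n%:~R *: v).
    apply/funext => v; rewrite /= (actM actP) (actB actP) (act_int actP).
    by congr (act d (_ - _)); apply: actE.
  exact: bij_comp.
have invE (d : {d : UG K | Dset d}) :
    exists f, cancel (act (sval d)) f /\ cancel f (act (sval d)).
  by have [f] := Dbij _ (svalP d); exists f.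
pose inv d := projT1 (cid (invE d)).
have invK d : cancel (act (sval d)) (inv d) by exact: (projT2 (cid (invE d))).1.
have invKV d : cancel (inv d) (act (sval d)) by exact: (projT2 (cid (invE d))).2.
pose g (z : UG K + {d : UG K | Dset d}) :=
  match z with inl u => act u | inr d => inv d end.
have [lact lactP lactE] : exists2 lact : Uloc K -> V -> V,
  is_action lact & forall z, lact (presented_gen _ z) =1 g z.
  apply: presented_action => [[u|d] a v w|s t [a|u u'|u u'|d|d] v] /=.
  - exact: act_lin.
  - by apply: (can_inj (invK d)); rewrite (act_lin actP) !invKV.
  - exact: actZ1.
  - exact: actD.
  - exact: actM.
  - by rewrite invKV scale1r.
  - by rewrite invK scale1r.
exists lact => // x v.
by rewrite -actE; apply: (lactE (inl (UG_in x))).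
Qed.

End UlocAction.

(** * Exchange of factors and torus: from the Lie superalgebra to [U] *)

Section Twist.
Variable K : numFieldType.
Local Notation e b := (osp_e K b).
Variables (s : bool) (xi : K).
Hypothesis xi0 : xi != 0.

Definition torus (x : osp K) : osp K := [ffun b => xi ^ weight b * x b].

Lemma torus_lin a x y : torus (a *: x + y) = a *: torus x + torus y.
Proof.
apply/ffunP => b; rewrite !ffunE -[a *: x b]/(a * x b) -[_ *: (_ * x b)]/(a * _).
by rewrite mulrDr mulrCA.
Qed.
Lemma torus0 : torus 0 = 0.
Proof. by apply/ffunP => b; rewrite !ffunE mulr0. Qed.
Lemma torusD x y : torus (x + y) = torus x + torus y.
Proof. by rewrite -[x in LHS]scale1r torus_lin scale1r. Qed.
Lemma torusZ a x : torus (a *: x) = a *: torus x.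
Proof. by rewrite -[_ *: x]addr0 torus_lin torus0 addr0. Qed.
Lemma torusN x : torus (- x) = - torus x.
Proof. by rewrite -scaleN1r torusZ scaleN1r. Qed.
Lemma torus_e b : torus (e b) = xi ^ weight b *: e b.
Proof.
apply/ffunP => c; rewrite !ffunE.
by have [->|_] := eqVneq c b; rewrite ?mulr0 ?scaler0.
Qed.

(** The bracket table is graded by weight; this is what makes [torus] compatible with brackets. *)
Lemma torus_br_basis a b :
  torus (osp_br_basis K a b) = xi ^ (weight a + weight b) *: osp_br_basis K a b.
Proof.
by case: a; case: b => /=;
  rewrite ?(torus0, torusN, torusZ, torus_e) ?scaler0 ?scalerN ?scalerA
    ?[_ * xi ^ _]mulrC.
Qed.

Lemma torus_br x y : osp_br (torus x) (torus y) = torus (osp_br x y).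
Proof.
rewrite /osp_br (big_morph torus torusD torus0); apply: eq_bigr => a _.
rewrite (big_morph torus torusD torus0); apply: eq_bigr => b _.
rewrite torusZ torus_br_basis scalerA !ffunE expfzDr //; congr (_ *: _).
by rewrite mulrACA mulrC.
Qed.

Definition twist (x : osp2 K) : osp2 K :=
  if s then (torus x.2, torus x.1) else (torus x.1, torus x.2).

Lemma twist_lin a x y : twist (a *: x + y) = a *: twist x + twist y.
Proof. by rewrite /twist; case: s; rewrite /= !torus_lin. Qed.

Lemma twist_br x y : osp2_br (twist x) (twist y) = twist (osp2_br x y).
Proof. by rewrite /twist /osp2_br; case: s; rewrite /= !torus_br. Qed.

Lemma twist_homog p x : osp2_homog p x -> osp2_homog p (twist x).
Proof.
move=> hx b /hx[x1 x2]; rewrite /twist.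
by case: s; rewrite /= !ffunE x1 x2 mulr0.
Qed.

Lemma twist_diag b : twist (e b, e b) = xi ^ weight b *: ((e b, e b) : osp2 K).
Proof. by rewrite /twist; case: s; rewrite /= torus_e. Qed.

Lemma twist_anti b :
  twist (e b, - e b) = ((-1) ^+ s * xi ^ weight b) *: ((e b, - e b) : osp2 K).
Proof.
rewrite /twist; case: s; rewrite /= torusN torus_e.
  rewrite -[RHS]/(_ *: _, _ *: _) expr1 mulN1r !scaleNr !scalerN.
  by rewrite opprK.
by rewrite -[RHS]/(_ *: _, _ *: _) expr0 mul1r scalerN.
Qed.

End Twist.

Section TwistMorphism.
Variable K : numFieldType.
Local Notation U := (Uloc K).
Local Notation e b := (osp_e K b).

Record is_algmor (f : U -> U) : Prop := IsAlgmor {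
  algmorZ1 : forall a, f (a *: (1 : U)) = a *: (1 : U);
  algmorD : {morph f : u v / u + v};
  algmorM : {morph f : u v / u * v} }.

Lemma algmor1 f : is_algmor f -> f 1 = 1.
Proof. by move=> fP; rewrite -[1]scale1r (algmorZ1 fP). Qed.
Lemma algmorZ f a u : is_algmor f -> f (a *: u) = a *: f u.
Proof.
move=> fP; rewrite -[u in LHS]mul1r presented_scaleAl (algmorM fP) (algmorZ1 fP).
by rewrite -presented_scaleAl mul1r.
Qed.
Lemma algmor_id : is_algmor id. Proof. by []. Qed.
Lemma algmor_comp f g : is_algmor f -> is_algmor g -> is_algmor (f \o g).
Proof.
move=> fP gP; split=> [a|u v|u v] /=.
- by rewrite (algmorZ1 gP) (algmorZ1 fP).
- by rewrite (algmorD gP) (algmorD fP).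
- by rewrite (algmorM gP) (algmorM fP).
Qed.

(** Unlike [Uloc_ind], the case of an inverse may assume the property for the element being
    inverted. *)
Lemma Uloc_loc_ind (P : U -> Prop) :
  (forall x, P (Uin x)) -> (forall a, P (a *: (1 : U))) ->
  (forall u v, P u -> P v -> P (u + v)) ->
  (forall u v, P u -> P v -> P (u * v)) ->
  (forall d, P (loc_in _ (sval d)) -> P (loc_inv d)) -> forall u, P u.
Proof.
move=> Px PZ1 PD PM Pinv.
have PU u : P (Uloc_in u).
  elim/presented_ind: u => [x|a|u v|u v].
  - exact: Px.
  - by rewrite [Uloc_in _]loc_inZ1.
  - by rewrite [Uloc_in (u + v)]loc_inD; apply: PD.
  - by rewrite [Uloc_in (u * v)]loc_inM; apply: PM.
elim/presented_ind => // -[u|d]; first exact: PU.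
exact/Pinv/PU.
Qed.

Lemma algmor_eq f g : is_algmor f -> is_algmor g ->
  (forall x, f (Uin x) = g (Uin x)) -> f =1 g.
Proof.
move=> fP gP fg; elim/Uloc_loc_ind => [x|a|u v IHu IHv|u v IHu IHv|d E].
- exact: fg.
- by rewrite (algmorZ1 fP) (algmorZ1 gP).
- by rewrite (algmorD fP) (algmorD gP) IHu IHv.
- by rewrite (algmorM fP) (algmorM gP) IHu IHv.
rewrite -[LHS]mulr1 -(algmor1 gP) -(loc_mulVr d) (algmorM gP) mulrA -E.
by rewrite -(algmorM fP) loc_mulrV (algmor1 fP) mul1r.
Qed.

(** Let [x] act on [U] by left multiplication by [Uin (twist s xi x)]. The resulting action commutes
    with right multiplications, so [u] acts as left multiplication by its value at 1, and that value
    is multiplicative in [u]. *)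
Lemma twist_morphism s (xi : K) : xi != 0 -> exists2 f : U -> U,
  is_algmor f & forall x, f (Uin x) = Uin (twist s xi x).
Proof.
move=> xi0; pose rho x (v : U) : U := Uin (twist s xi x) * v.
have rhoH n v : rho (e xh, e xh) v - n%:~R *: v = (Hdiag K - n%:~R) * v.
  rewrite /rho twist_diag expr0z scale1r mulrBl.
  by rewrite mulrzl scaler_int.
have [||p q x y v hx hy|n|act actP actE] := @Uloc_action K U rho.
- by move=> x a u v; rewrite /rho mulrDr -presented_scaleAr.
- by move=> a x y v; rewrite /rho twist_lin Uin_lin mulrDl -presented_scaleAl.
- rewrite /rho -twist_br // !mulrA (UinC (twist_homog s xi hx) (twist_homog s xi hy)).
  by rewrite mulrDl -presented_scaleAl.
- have [E1 E2] := HinvP K n; exists (fun v => Hinv K n * v) => v.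
    by rewrite rhoH mulrA E2 mul1r.
  by rewrite rhoH mulrA E1 mul1r.
have actK u : forall v, act u v = act u 1 * v.
  elim/Uloc_loc_ind: u => [x|a|u w IHu IHw|u w IHu IHw|d IH] v.
  - by rewrite !actE /rho mulr1.
  - by rewrite !(actZ1 actP) -presented_scaleAl mul1r.
  - by rewrite !(actD actP) IHu IHw mulrDl.
  - by rewrite !(actM actP) IHu IHw mulrA -IHu.
  have dK w : act (loc_inv d) (act (loc_in _ (sval d)) w) = w.
    by rewrite -(actM actP) loc_mulrV (act1 actP).
  have Kd w : act (loc_in _ (sval d)) (act (loc_inv d) w) = w.
    by rewrite -(actM actP) loc_mulVr (act1 actP).
  (* Both sides are compared after applying the inverted element, which acts by left multiplication
     by the induction hypothesis. *)
  by apply: (can_inj dK); rewrite Kd IH mulrA -IH Kd mul1r.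
exists (act^~ 1) => [|x]; last by rewrite actE /rho mulr1.
split=> [a|u v|u v]; first exact: actZ1.
- by rewrite (actD actP).
- by rewrite (actM actP) actK.
Qed.

End TwistMorphism.

(** * Descent of the twists to automorphisms of the reduction algebra *)

Section TwistAut.
Variable K : numFieldType.
Local Notation U := (Uloc K).
Local Notation e b := (osp_e K b).

Lemma torus_comp (xi zt : K) x : xi != 0 -> zt != 0 ->
  torus xi (torus zt x) = torus (xi * zt) x.
Proof. by move=> x0 z0; apply/ffunP => b; rewrite !ffunE mulrA -expfzMl. Qed.

Lemma twist_comp s t (xi zt : K) x : xi != 0 -> zt != 0 ->
  twist s xi (twist t zt x) = twist (s (+) t) (xi * zt) x.
Proof.
by move=> x0 z0; rewrite /twist; case: s; case: t; rewrite /= !torus_comp.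
Qed.

Lemma twist_id x : twist false (1 : K) x = x.
Proof.
case: x => x y; congr (_, _); apply/ffunP => b;
  by rewrite ffunE exp1rz mul1r.
Qed.

Definition twist_mor s (xi : unit_group K) : U -> U :=
  s2val (cid2 (twist_morphism s (valP xi))).

Lemma twist_morP s xi : is_algmor (twist_mor s xi).
Proof. exact: s2valP (cid2 (twist_morphism s (valP xi))). Qed.

Lemma twist_morE s xi x : twist_mor s xi (Uin x) = Uin (twist s (val xi) x).
Proof. exact: (s2valP' (cid2 (twist_morphism s (valP xi))) x). Qed.

Lemma twist_mor_comp s t (xi zt : unit_group K) u :
  twist_mor s xi (twist_mor t zt u) = twist_mor (s (+) t) (xi * zt)%g u.
Proof.
apply: (algmor_eq (algmor_comp (twist_morP s xi) (twist_morP t zt))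
  (twist_morP (s (+) t) (xi * zt)%g)) => x.
by rewrite /= !twist_morE twist_comp //; [exact: (valP xi)|exact: (valP zt)].
Qed.

Lemma twist_mor_id u : twist_mor false 1%g u = u.
Proof.
apply: (algmor_eq (twist_morP false 1%g) (@algmor_id K)) => x.
by rewrite twist_morE twist_id.
Qed.

Section Fixed.
Variables (s : bool) (xi : unit_group K).
Local Notation f := (twist_mor s xi).

Let fP : is_algmor f := twist_morP s xi.

Lemma twist_Xdiag b : f (Xdiag K b) = val xi ^ weight b *: Xdiag K b.
Proof. by rewrite [LHS]twist_morE twist_diag UinZ. Qed.

Lemma twist_Xtilde b :
  f (Xtilde K b) = ((-1) ^+ s * val xi ^ weight b) *: Xtilde K b.
Proof. by rewrite [LHS]twist_morE twist_anti UinZ. Qed.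

Lemma twist_Hdiag : f (Hdiag K) = Hdiag K.
Proof. by rewrite [LHS]twist_Xdiag expr0z scale1r. Qed.

Lemma twist_Hinv n : f (Hinv K n) = Hinv K n.
Proof.
have [E1 E2] := HinvP K n.
have fn : f n%:~R = n%:~R.
  by have := algmorZ1 fP n%:~R; rewrite !scaler_int.
have fN u : f (- u) = - f u by rewrite -scaleN1r (algmorZ _ _ fP) scaleN1r.
have fH : f (Hdiag K - n%:~R) = Hdiag K - n%:~R.
  by rewrite (algmorD fP) fN fn twist_Hdiag.
by rewrite -[LHS]mulr1 -E1 mulrA -{1}fH -(algmorM fP) E2 (algmor1 fP) mul1r.
Qed.

Lemma twist_phi n : f (dra_phi K n) = dra_phi K n.
Proof.
elim: n => [|n IHn]; first exact: algmor1.
rewrite [dra_phi _ _]/=; case: ifP => _; last by rewrite (algmorZ _ _ fP) IHn.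
by rewrite (algmorM fP) -scaleN1r (algmorZ _ _ fP) twist_Hinv IHn.
Qed.

Lemma twist_exp u n : f (u ^+ n) = f u ^+ n.
Proof.
by elim: n => [|n IHn]; [exact: algmor1|rewrite !exprS (algmorM fP) IHn].
Qed.

Lemma Uloc_exprZ (a : K) (u : U) n : (a *: u) ^+ n = a ^+ n *: u ^+ n.
Proof.
elim: n => [|n IHn]; first by rewrite scale1r.
by rewrite exprS IHn -presented_scaleAl -presented_scaleAr scalerA -!exprS.
Qed.

(** The powers of [X_-alpha] and [X_alpha] in a term have equal exponents, so the factors [xi^-n]
    and [xi^n] cancel. *)
Lemma twist_term u v n : f (diamond_term u v n) = diamond_term (f u) (f v) n.
Proof.
rewrite /diamond_term !(algmorM fP) twist_phi !twist_exp !twist_Xdiag /=.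
rewrite !Uloc_exprZ; do 3! rewrite -?presented_scaleAr -?presented_scaleAl.
rewrite scalerA -exprMn.
by rewrite mulfV ?expr1n ?scale1r //; exact: (valP xi).
Qed.

Lemma twist_inJ u : inJ u -> inJ (f u).
Proof.
move=> /inJP[a [b ->]]; rewrite (algmorD fP) !(algmorM fP) !twist_Xdiag.
by apply: inJD; rewrite -?presented_scaleAl -?presented_scaleAr;
  apply: inJZ; [exact: inJ_l|exact: inJ_r].
Qed.

Definition twist_fun (a : dra K) : dra K := dra_pi (f (repr a)).

Lemma twist_pi u : twist_fun (dra_pi u) = dra_pi (f u).
Proof.
apply/dra_piP.
rewrite -[- f u]scaleN1r -(algmorZ _ _ fP) scaleN1r -(algmorD fP).
by apply/twist_inJ/dra_piP; rewrite dra_pi_repr.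
Qed.

Fact twist_fun_linear : linear twist_fun.
Proof.
move=> a; elim/dra_pi_ind => u; elim/dra_pi_ind => v.
have E x y : a *: dra_pi x + dra_pi y = dra_pi (a *: x + y) :> dra K.
  by rewrite dra_piD dra_piZ.
by rewrite E !twist_pi E (algmorD fP) (algmorZ _ _ fP).
Qed.

Fact twist_fun_monoid : GRing.monoid_morphism twist_fun.
Proof.
split; first by rewrite [LHS]twist_pi (algmor1 fP).
elim/dra_pi_ind => u; elim/dra_pi_ind => v.
have [N hN] := diamond_term_l u; have [M hM] := diamond_term_l (f u).
rewrite !twist_pi !dra_mulE (@diamond_repE _ _ _ (maxn N M)); last first.
  by move=> n; rewrite geq_max => /andP[/hN + _]; apply.
rewrite (@diamond_repE _ _ _ (maxn N M)); last first.
  by move=> n; rewrite geq_max => /andP[_ /hM]; apply.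
have f0 : f 0 = 0 by rewrite -(scale0r (1 : U)) (algmorZ _ _ fP) !scale0r.
rewrite twist_pi (big_morph f (algmorD fP) f0); congr dra_pi.
by apply: eq_bigr => n _; apply: twist_term.
Qed.

End Fixed.

Lemma twist_fun_comp s t (xi zt : unit_group K) a :
  twist_fun s xi (twist_fun t zt a) = twist_fun (s (+) t) (xi * zt)%g a.
Proof. by elim/dra_pi_ind: a => u; rewrite !twist_pi twist_mor_comp. Qed.

Lemma twist_fun_id a : twist_fun false 1%g a = a.
Proof. by elim/dra_pi_ind: a => u; rewrite twist_pi twist_mor_id. Qed.

Fact twist_fun_bij s xi : bijective (twist_fun s xi).
Proof.
by exists (twist_fun s xi^-1%g) => a; rewrite twist_fun_comp addbb;
  rewrite ?mulVg ?mulgV twist_fun_id.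
Qed.

Definition twist_aut s xi : dra_aut K :=
  DraAut (twist_fun_linear s xi) (twist_fun_monoid s xi) (twist_fun_bij s xi).

Lemma twist_aut_xbar s xi b :
  twist_aut s xi (xbar K b) = ((-1) ^+ s * val xi ^ weight b) *: xbar K b.
Proof. by rewrite [LHS]twist_pi twist_Xtilde dra_piZ. Qed.

Lemma twist_aut_Hbar s xi : twist_aut s xi (Hbar K) = Hbar K.
Proof. by rewrite [LHS]twist_pi twist_Hdiag. Qed.

Lemma twist_aut_mul s t xi zt :
  twist_aut (s (+) t) (xi * zt)%g = (twist_aut s xi * twist_aut t zt)%g.
Proof. by apply: dra_aut_eq => a; apply/esym/twist_fun_comp. Qed.

End TwistAut.

(** * Generation of [U / J] and uniqueness of automorphisms *)

Section Generation.
Variable K : numFieldType.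
Local Notation U := (Uloc K).
Local Notation e b := (osp_e K b).
Local Notation xp := (Xdiag K xp1).
Local Notation xm := (Xdiag K xm1).
Local Notation h := (Hdiag K).

Lemma dra_mul_expand (u v : U) : exists N,
  dra_pi u * dra_pi v = dra_pi (u * v)
    + \sum_(n < N) dra_pi (u * dra_phi K n.+1 * xm ^+ n.+1 * xp ^+ n.+1 * v).
Proof.
have [N hN] := diamond_term_l u; exists N.
rewrite dra_mulE (@diamond_repE _ _ _ N.+1) => [|n /ltnW]; last exact: hN.
rewrite (big_morph (@dra_pi K) (@dra_piD K) (@dra_pi0 K)) big_ord_recl.
by rewrite /diamond_term /= !mulr1.
Qed.

(** Every correction term can be rewritten to end in [X_alpha], so it lies in [J]. *)
Lemma dra_mul_weight0 (u v w : U) : xp * v = w * xp ->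
  dra_pi u * dra_pi v = dra_pi (u * v).
Proof.
move=> vw; have [N ->] := dra_mul_expand u v.
rewrite big1 ?addr0 // => n _.
by rewrite [xp ^+ _]exprSr -!mulrA vw !mulrA; apply/dra_pi_eq0/inJ_r.
Qed.

Lemma X_tilde a b :
  Xdiag K a * Xtilde K b = Uin (osp_br_basis K a b, - osp_br_basis K a b) +
    (-1) ^+ (odd_basis a && odd_basis b) *: (Xtilde K b * Xdiag K a).
Proof.
have eE c : (e c, - e c) = ((e c, 0) : osp2 K) + (-1) *: ((0, e c) : osp2 K).
  by rewrite -[RHS]/(_ + _ *: _, _ + _ *: _) scaler0 addr0 add0r scaleN1r.
have bE (x : osp K) : (x, - x) = ((x, 0) : osp2 K) + (-1) *: ((0, x) : osp2 K).
  by rewrite -[RHS]/(_ + _ *: _, _ + _ *: _) scaler0 addr0 add0r scaleN1r.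
have -> : Xtilde K b = Uin (e b, 0) - Uin (0, e b).
  by rewrite [LHS](congr1 (@Uin K) (bE _)) UinD UinZ scaleN1r.
rewrite bE UinD UinZ scaleN1r mulrBr X_lcomm X_rcomm mulrBl scalerBr.
by rewrite addrACA opprD.
Qed.

Lemma UinZtilde a b :
  Uin (a *: e b, - (a *: e b)) = a *: Xtilde K b.
Proof. by rewrite -scalerN -[LHS]/(Uin (a *: ((e b, - e b) : osp2 K))) UinZ. Qed.
Lemma Uin_tilde0 : Uin (0 : osp K, - 0) = 0.
Proof. by rewrite oppr0 [LHS]Uin0. Qed.

Lemma tilde_shift (n : int) b :
  (h - n%:~R) * Xtilde K b = Xtilde K b * (h - (n + weight b)%:~R).
Proof.
rewrite mulrBl [h * _]X_tilde /= expr0 scale1r UinZtilde mulrBr.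
rewrite addrAC addrC; congr (_ + _).
rewrite mulrzl mulrzr scaler_int mulrzDr mulrNz opprD addrC.
by [].
Qed.

Lemma Dset_tilde b d : Dset d ->
  exists2 d', Dset d' & Uloc_in d * Xtilde K b = Xtilde K b * Uloc_in d' :> U.
Proof.
elim=> [|{}d n _ [d' Dd' E]].
  by exists 1; [exact: Dset1 | rewrite /Uloc_in loc_in1 mul1r mulr1].
exists (d' * (UG_H K - (n + weight b)%:~R)); first exact: DsetM.
by rewrite !Uloc_inM !UG_H_in -mulrA tilde_shift mulrA E -mulrA.
Qed.

Lemma loc_inv_tilde b d : exists d',
  loc_inv d * Xtilde K b = Xtilde K b * loc_inv d' :> U.
Proof.
have [d' Dd' E] := Dset_tilde b (svalP d); exists (exist (@Dset K) d' Dd').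
rewrite -[LHS]mulr1 -(loc_mulVr (exist (@Dset K) d' Dd')) mulrA; congr (_ * _).
by rewrite -mulrA -[Xtilde K b * _]E mulrA loc_mulrV mul1r.
Qed.

(** Letters are appended on the right because, in [y * w], a letter standing at the front of [w] is
    absorbed into [y]. There is no letter [X_-alpha]: it is moved to the left end, where it falls
    into [J]. *)
Inductive borel_word : U -> Prop :=
| BorelW1 : borel_word 1
| BorelWxp y : borel_word y -> borel_word (y * xp)
| BorelWh y : borel_word y -> borel_word (y * h)
| BorelWinv y d : borel_word y -> borel_word (y * loc_inv d).

Variable S : dra K -> Prop.
Hypothesis S1 : S 1.
Hypothesis SD : forall a b, S a -> S b -> S (a + b).
Hypothesis SZ : forall (c : K) a, S a -> S (c *: a).
Hypothesis SM : forall a b, S a -> S b -> S (a * b).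
Hypothesis SH : S (Hbar K).
Hypothesis Sx : forall b, S (xbar K b).
Hypothesis Sinv : forall d, S (dra_pi (loc_inv d)).

Let S0 : S 0. Proof. by rewrite -(scale0r (1 : dra K)); apply: SZ. Qed.
Let SN a : S a -> S (- a). Proof. by rewrite -scaleN1r; apply: SZ. Qed.
Let Spi (u v : U) : S (dra_pi u) -> S (dra_pi v) -> S (dra_pi (u + v)).
Proof. by rewrite dra_piD; apply: SD. Qed.
Let SpiZ c (u : U) : S (dra_pi u) -> S (dra_pi (c *: u)).
Proof. by rewrite dra_piZ; apply: SZ. Qed.

(* The elements stable, modulo J, under the positive Borel part of the diagonal
   subalgebra; the generators are shown to preserve this set, so it is all of U. *)
Definition borel_stable (w : U) : Prop :=
  forall y, borel_word y -> S (dra_pi (y * w)).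

Lemma stableD v w : borel_stable v -> borel_stable w -> borel_stable (v + w).
Proof. by move=> Nv Nw y By; rewrite mulrDr; apply: Spi; [exact: Nv|exact: Nw]. Qed.
Lemma stableZ c w : borel_stable w -> borel_stable (c *: w).
Proof. by move=> Nw y By; rewrite -presented_scaleAr; apply/SpiZ/Nw. Qed.
Lemma stableN w : borel_stable w -> borel_stable (- w).
Proof. by rewrite -scaleN1r; apply: stableZ. Qed.
Lemma stable_xp w : borel_stable w -> borel_stable (xp * w).
Proof. by move=> Nw y By; rewrite mulrA; apply/Nw/BorelWxp. Qed.
Lemma stable_h w : borel_stable w -> borel_stable (h * w).
Proof. by move=> Nw y By; rewrite mulrA; apply/Nw/BorelWh. Qed.
Lemma stable_inv d w : borel_stable w -> borel_stable (loc_inv d * w).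
Proof. by move=> Nw y By; rewrite mulrA; apply/Nw/BorelWinv. Qed.

(** Moving [X_-alpha] leftwards through a word leaves only Borel letters next to [w]; once at the
    front it gives an element of [J]. *)
Lemma stable_xm w : borel_stable w -> borel_stable (xm * w).
Proof.
move=> + y By; elim: By w => {y} [|y By IH|y By IH|y d By IH] w Nw.
- by rewrite mul1r dra_pi_eq0 //; apply: inJ_l.
- rewrite mulrA -[y * xp * xm]mulrA xpm mulrBr mulrBl -!mulrA -scaleN1r.
  apply/Spi/SpiZ; first exact/stable_h.
  exact/IH/stable_xp.
- have -> : y * h * (xm * w) = y * (xm * (h * w)) + y * (xm * w).
    rewrite -mulrDr -mulrA; congr (_ * _).
    by rewrite !mulrA xmh mulrBl subrK.
  by apply: Spi; apply: IH => //; apply: stable_h.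
- have [d' E] := loc_inv_xm d.
  rewrite mulrA -[y * _ * xm]mulrA E -!mulrA; exact/IH/stable_inv.
Qed.

(** Lets [X_-alpha] be brought next to the generator on the left of a correction term, at the price
    of a factor that preserves stability. *)
Lemma phi_xm_stable n : exists g, dra_phi K n * xm = xm * g /\
  forall w, borel_stable w -> borel_stable (g * w).
Proof.
elim: n => [|n [g [E Ng]]]; first by exists 1; split=> [|w]; rewrite ?mul1r ?mulr1.
rewrite [dra_phi _ _]/=; case: ifP => _.
  have [d' E'] := loc_inv_xm (exist (@Dset K) _ (Dset_gen K (uphalf n.+1))).
  exists (- (loc_inv d' * g)); split=> [|w Nw].
    by rewrite -mulrA E mulrA mulNr [Hinv _ _ * _]E' mulrN !mulNr mulrA.
  by rewrite mulNr -mulrA; apply/stableN/stable_inv/Ng.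
exists (((uphalf n.+1)%:R^-1 : K) *: g); split=> [|w Nw].
  by rewrite -presented_scaleAl E presented_scaleAr.
by rewrite -presented_scaleAl; apply/stableZ/Ng.
Qed.

Lemma stable_exp z n w : (forall v, borel_stable v -> borel_stable (z * v)) ->
  borel_stable w -> borel_stable (z ^+ n * w).
Proof.
move=> Nz; elim: n w => [|n IHn] w Nw; first by rewrite mul1r.
by rewrite exprSr -mulrA; apply/IHn/Nz.
Qed.

(** Induction on the weight of [b]. By [step], it suffices to treat [Xtilde b * xm * w]. There [xm]
    is moved to the front, where it is killed by [J]; the supercommutator left behind is a multiple
    of the antidiagonal generator of next lower weight, and is zero at [-2 alpha]. *)
Lemma stable_tilde1 b : forall w, borel_stable w -> S (dra_pi (Xtilde K b * w)).
Proof.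
have step (b' : osp_basis) : (forall w, borel_stable w -> S (dra_pi (Xtilde K b' * xm * w))) ->
    forall w, borel_stable w -> S (dra_pi (Xtilde K b' * w)).
  move=> IH w Nw.
  (* The expansion of the product is solved for its leading term: the product itself is in [S], and
     every correction has the shape covered by [IH]. *)
  have [N /esym/(canRL (addrK _)) ->] := dra_mul_expand (Xtilde K b') w.
  rewrite -sumrN; apply: SD.
    by apply: SM; [exact: Sx|rewrite -[w]mul1r; apply: Nw; apply: BorelW1].
  elim/big_ind: _ => // n _; apply: SN.
  have [g [E Ng]] := phi_xm_stable n.+1.
  rewrite [xm ^+ _]exprS !mulrA -[_ * dra_phi K _ * xm]mulrA E !mulrA.
  rewrite -3!mulrA; apply: IH.
  by apply: Ng; apply: stable_exp => [v|]; [exact: stable_xm|];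
    apply: stable_exp => [v|]; [exact: stable_xp|].
have comm (b' : osp_basis) (r : U) : xm * Xtilde K b' = r
    + (-1) ^+ (odd_basis xm1 && odd_basis b') *: (Xtilde K b' * xm) ->
    (forall w, borel_stable w -> S (dra_pi (r * w))) ->
    forall w, borel_stable w -> S (dra_pi (Xtilde K b' * w)).
  move=> E Sr; apply: step => w Nw.
  have -> : Xtilde K b' * xm = (-1) ^+ (odd_basis xm1 && odd_basis b') *: (xm * Xtilde K b' - r).
    by rewrite E addrC addKr scalerA -expr2 sqrr_sign scale1r.
  rewrite -presented_scaleAl; apply: SpiZ; rewrite mulrBl -scaleN1r.
  apply/Spi/SpiZ/Sr => //.
  by rewrite -mulrA dra_pi_eq0 //; apply: inJ_l.
have T2 : forall w, borel_stable w -> S (dra_pi (Xtilde K xm2 * w)).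
  apply: (comm xm2 _ (X_tilde xm1 xm2)) => w _.
  by rewrite Uin_tilde0 mul0r dra_pi0.
have T1 : forall w, borel_stable w -> S (dra_pi (Xtilde K xm1 * w)).
  apply: (comm xm1 _ (X_tilde xm1 xm1)) => w Nw.
  by rewrite UinZtilde -presented_scaleAl; apply/SpiZ/T2.
have Th : forall w, borel_stable w -> S (dra_pi (Xtilde K xh * w)).
  apply: (comm xh _ (X_tilde xm1 xh)) => w Nw.
  by rewrite UinZtilde -presented_scaleAl; apply/SpiZ/T1.
have Tp1 : forall w, borel_stable w -> S (dra_pi (Xtilde K xp1 * w)).
  by apply: (comm xp1 _ (X_tilde xm1 xp1)).
have Tp2 : forall w, borel_stable w -> S (dra_pi (Xtilde K xp2 * w)).
  by apply: (comm xp2 _ (X_tilde xm1 xp2)).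
by case: b.
Qed.

(** Commuting a letter of the word past [Xtilde b] yields antidiagonal generators again, with a
    shorter word in front of them. *)
Lemma stable_tilde b w : borel_stable w -> borel_stable (Xtilde K b * w).
Proof.
move=> + y By; elim: By b w => {y} [|y By IH|y By IH|y d By IH] b w Nw.
- by rewrite mul1r; apply: stable_tilde1.
- rewrite mulrA -[y * xp * _]mulrA X_tilde mulrDr mulrDl; apply: Spi.
    rewrite -mulrA.
    by case: b; rewrite /= ?UinZtilde -?presented_scaleAl -?presented_scaleAr;
      rewrite ?Uin_tilde0 ?mul0r ?mulr0 ?dra_pi0 //; try apply: SpiZ; apply: IH.
  rewrite -presented_scaleAr -presented_scaleAl; apply: SpiZ.
  rewrite -2!mulrA; exact/IH/stable_xp.
- rewrite mulrA -[y * h * _]mulrA X_tilde mulrDr mulrDl; apply: Spi.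
    rewrite /= UinZtilde -presented_scaleAr -presented_scaleAl -mulrA.
    exact/SpiZ/IH.
  rewrite -presented_scaleAr -presented_scaleAl; apply: SpiZ.
  rewrite -2!mulrA; exact/IH/stable_h.
- have [d' E] := loc_inv_tilde b d.
  rewrite mulrA -[y * _ * _]mulrA E -!mulrA; exact/IH/stable_inv.
Qed.

Lemma stable1 : borel_stable 1.
Proof.
move=> y; rewrite mulr1; elim=> {y} [|y _ IH|y _ IH|y d _ IH].
- exact: S1.
- by rewrite dra_pi_eq0 //; apply: inJ_r.
- rewrite -(@dra_mul_weight0 y h (h + 1)); first exact: SM.
  by rewrite xph mulrDl mul1r.
- have [d' E] := loc_inv_xp d.
  by rewrite -(dra_mul_weight0 _ E); apply: SM.
Qed.

Lemma stable_Xdiag b w : borel_stable w -> borel_stable (Xdiag K b * w).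
Proof.
move=> Nw; case: b.
- by rewrite X_m2 -mulrA; do 2! apply: stable_xm.
- exact: stable_xm.
- exact: stable_h.
- exact: stable_xp.
- by rewrite X_p2 mulNr -mulrA; apply/stableN; do 2! apply: stable_xp.
Qed.

Lemma Uin_el b : Uin (e b, 0) = (2^-1 : K) *: (Xdiag K b + Xtilde K b).
Proof.
rewrite -[Xdiag K b]/(Uin _) -[Xtilde K b]/(Uin _) -UinD -UinZ.
congr Uin; rewrite -[RHS]/(_ *: (_ + _), _ *: (_ + _)) subrr scaler0.
by rewrite -mulr2n -scaler_nat scalerA mulVf ?scale1r // pnatr_eq0.
Qed.
Lemma Uin_er b : Uin (0, e b) = (2^-1 : K) *: (Xdiag K b - Xtilde K b).
Proof.
rewrite -[Xdiag K b]/(Uin _) -[Xtilde K b]/(Uin _) -scaleN1r -UinZ -UinD -UinZ.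
congr Uin; rewrite -[RHS]/(_ *: (_ + _ *: _), _ *: (_ + _ *: _)).
rewrite !scaleN1r opprK subrr scaler0.
by rewrite -mulr2n -scaler_nat scalerA mulVf ?scale1r // pnatr_eq0.
Qed.

(** [S] plays the role of a subalgebra containing all generators. Since [U] preserves the stable
    elements and 1 is stable, every [u * 1] is stable. *)
Lemma dra_gen_ind a : S a.
Proof.
elim/dra_pi_ind: a => u; suff Nu w : borel_stable w -> borel_stable (u * w).
  by rewrite -[u]mul1r -[u]mulr1; apply: Nu => //; [exact: stable1|exact: BorelW1].
elim/Uloc_ind: u w => [c|u v IHu IHv|u v IHu IHv|b|b|d] w Nw.
- by rewrite -presented_scaleAl mul1r; apply: stableZ.
- by rewrite mulrDl; apply: stableD; [exact: IHu|exact: IHv].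
- by rewrite -mulrA; apply/IHu/IHv.
- rewrite Uin_el -presented_scaleAl mulrDl; apply/stableZ/stableD.
    exact: stable_Xdiag.
  exact: stable_tilde.
- rewrite Uin_er -presented_scaleAl mulrBl; apply/stableZ/stableD.
    exact: stable_Xdiag.
  exact/stableN/stable_tilde.
- exact: stable_inv.
Qed.

End Generation.

Section AutGeneration.
Variable K : numFieldType.
Local Notation h := (Hdiag K).

(** [dra_gen_ind] is applied to the set where [s] and [t] agree. Only the inverses of elements of
    [Dset] need work. *)
Lemma dra_aut_ext (s t : dra_aut K) :
  (forall b, s (xbar K b) = t (xbar K b)) -> s (Hbar K) = t (Hbar K) -> s = t.
Proof.
move=> stx stH.
have [[s1 sM] [t1 tM]] := (dra_aut_monoid s, dra_aut_monoid t).
have D (f : dra_aut K) a b : f (a + b) = f a + f b.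
  by have := dra_aut_linear f 1 a b; rewrite !scale1r.
apply: dra_aut_eq; apply: dra_gen_ind => [|a b|c a|a b|//|//|d].
- by rewrite s1 t1.
- by rewrite !D => -> ->.
- by rewrite !dra_aut_scale => ->.
- by rewrite sM tM => -> ->.
have dE : s (dra_pi (loc_in _ (sval d))) = t (dra_pi (loc_in _ (sval d))).
  rewrite -[loc_in _ _]/(Uloc_in (sval d)); elim: (svalP d) => [|{}d' n _ IH].
    by rewrite [Uloc_in _]loc_in1 s1 t1.
  rewrite Uloc_inM UG_H_in.
  have E : dra_pi (Uloc_in d') * (Hbar K + (- n%:~R : K) *: (1 : dra K)) =
      dra_pi (Uloc_in d' * (h - n%:~R)).
    rewrite -(@dra_mul_weight0 K _ (h - n%:~R) (h - (n - 1)%:~R)); last exact: xp_shift.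
    have -> : (- n%:~R : K) *: (1 : dra K) = dra_pi ((- n%:~R : K) *: (1 : Uloc K)).
      exact/esym/dra_piZ.
    by rewrite -[Hbar K + _]dra_piD scaleNr scaler_int.
  by rewrite -E sM tM IH !D !dra_aut_scale s1 t1 stH.
(* Elements of [Dset] and their inverses pass through [X_alpha] up to a shift, so they remain
   mutually inverse for the diamond product. *)
have VrE : dra_pi (loc_in _ (sval d)) * dra_pi (loc_inv d) = 1 :> dra K.
  by have [d' E] := loc_inv_xp d; rewrite (dra_mul_weight0 _ E) loc_mulVr.
have rVE : dra_pi (loc_inv d) * dra_pi (loc_in _ (sval d)) = 1 :> dra K.
  have [d' _ E] := Dset_xp (svalP d).
  by rewrite (dra_mul_weight0 _ E) [Uloc_in _]/(loc_in _ _) loc_mulrV.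
rewrite -[LHS]mulr1 -t1 -VrE tM mulrA -dE -sM rVE s1.
by rewrite mul1r.
Qed.

End AutGeneration.

(** * Representations of the product of two copies, given on basis vectors *)

Section BasisAction.
Variables (K : numFieldType) (V : lmodType K).
Local Notation e b := (osp_e K b).
Variable G : bool -> osp_basis -> V -> V.

Definition factor_rep s (x : osp K) (v : V) : V := \sum_b x b *: G s b v.

Lemma factor_rep_lin s a x y v :
  factor_rep s (a *: x + y) v = a *: factor_rep s x v + factor_rep s y v.
Proof.
rewrite /factor_rep scaler_sumr -big_split; apply: eq_bigr => b _.
by rewrite !ffunE scalerDl scalerA.
Qed.
Lemma factor_rep0 s v : factor_rep s 0 v = 0.
Proof. by apply: big1 => b _; rewrite ffunE scale0r. Qed.
Lemma factor_repD s x y v :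
  factor_rep s (x + y) v = factor_rep s x v + factor_rep s y v.
Proof. by rewrite -[x in LHS]scale1r factor_rep_lin scale1r. Qed.
Lemma factor_repZ s a x v : factor_rep s (a *: x) v = a *: factor_rep s x v.
Proof. by rewrite -[_ *: x]addr0 factor_rep_lin factor_rep0 addr0. Qed.
Lemma factor_repN s x v : factor_rep s (- x) v = - factor_rep s x v.
Proof. by rewrite -[- x]scaleN1r factor_repZ scaleN1r. Qed.
Lemma factor_rep_e s b v : factor_rep s (e b) v = G s b v.
Proof.
rewrite /factor_rep (bigD1 b) //= ffunE eqxx scale1r big1 ?addr0 // => c cb.
by rewrite ffunE (negPf cb) scale0r.
Qed.
Definition factor_repE :=
  (factor_rep0, factor_repN, factor_repZ, factor_rep_e).

Hypothesis G_lin : forall s b, linear (G s b).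
Hypothesis G_br : forall s a b v, G s a (G s b v) =
  factor_rep s (osp_br_basis K a b) v
  + (-1) ^+ (odd_basis a && odd_basis b) *: G s b (G s a v).
Hypothesis G_cross : forall a b v, G false a (G true b v) =
  (-1) ^+ (odd_basis a && odd_basis b) *: G true b (G false a v).

Lemma factor_rep_linear s x : linear (factor_rep s x).
Proof.
move=> a u v; rewrite /factor_rep scaler_sumr -big_split.
by apply: eq_bigr => b _; rewrite G_lin scalerDr !scalerA mulrC.
Qed.

Let G0 s b : G s b 0 = 0.
Proof.
by have := G_lin s b (-1) 0 0; rewrite scaler0 addr0 scaleN1r addNr.
Qed.

Let G_sum s a (F : osp_basis -> K) (w : osp_basis -> V) :
  G s a (\sum_b F b *: w b) = \sum_b F b *: G s a (w b).
Proof. by elim/big_rec2: _ => // b x y _ <-; apply: G_lin. Qed.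

Lemma factor_rep_comp s t x y v : factor_rep s x (factor_rep t y v) =
  \sum_a \sum_b (x a * y b) *: G s a (G t b v).
Proof.
apply: eq_bigr => a _; rewrite G_sum scaler_sumr.
by apply: eq_bigr => b _; rewrite scalerA.
Qed.

Definition homog1 p (x : osp K) := forall b, odd_basis b != p -> x b = 0.

(** Coordinates of the wrong parity vanish, so the sign attached to basis vectors may be replaced by
    the one attached to [x] and [y]. *)
Lemma homog1_sign p q x y a b (w : V) : homog1 p x -> homog1 q y ->
  (x a * y b) *: ((-1) ^+ (odd_basis a && odd_basis b) *: w) =
  (-1) ^+ (p && q) *: ((y b * x a) *: w).
Proof.
move=> hx hy; have [<-|/hx->] := eqVneq (odd_basis a) p; last first.
  by rewrite mul0r mulr0 !scale0r scaler0.
have [<-|/hy->] := eqVneq (odd_basis b) q; last first.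
  by rewrite mul0r mulr0 !scale0r scaler0.
by rewrite !scalerA mulrC [y b * _]mulrC.
Qed.

Lemma factor_rep_br s p q x y v : homog1 p x -> homog1 q y ->
  factor_rep s x (factor_rep s y v) = factor_rep s (osp_br x y) v
    + (-1) ^+ (p && q) *: factor_rep s y (factor_rep s x v).
Proof.
move=> hx hy; rewrite !factor_rep_comp [in X in _ + X]exchange_big /=.
rewrite [in X in X + _]/osp_br.
rewrite (big_morph (factor_rep s ^~ v) (fun x y => factor_repD s x y v) (factor_rep0 s v)).
rewrite scaler_sumr -big_split; apply: eq_bigr => a _.
rewrite (big_morph (factor_rep s ^~ v) (fun x y => factor_repD s x y v) (factor_rep0 s v)).
rewrite scaler_sumr -big_split; apply: eq_bigr => b _.
by rewrite /= G_br scalerDr factor_repZ (homog1_sign _ _ _ hx hy).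
Qed.

Lemma factor_rep_cross p q x y v : homog1 p x -> homog1 q y ->
  factor_rep false x (factor_rep true y v) =
  (-1) ^+ (p && q) *: factor_rep true y (factor_rep false x v).
Proof.
move=> hx hy; rewrite !factor_rep_comp [in RHS]exchange_big /=.
rewrite scaler_sumr; apply: eq_bigr => a _.
rewrite scaler_sumr; apply: eq_bigr => b _.
by rewrite G_cross (homog1_sign _ _ _ hx hy).
Qed.

Definition pair_rep (x : osp2 K) v := factor_rep false x.1 v + factor_rep true x.2 v.

Lemma pair_rep_linear x : linear (pair_rep x).
Proof.
by move=> a u v; rewrite /pair_rep !factor_rep_linear scalerDr addrACA.
Qed.

Lemma pair_rep_linl a x y v : pair_rep (a *: x + y) v = a *: pair_rep x v + pair_rep y v.
Proof. by rewrite /pair_rep !factor_rep_lin scalerDr addrACA. Qed.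

Lemma pair_rep_br p q x y v : osp2_homog p x -> osp2_homog q y ->
  pair_rep x (pair_rep y v) =
  pair_rep (osp2_br x y) v + (-1) ^+ (p && q) *: pair_rep y (pair_rep x v).
Proof.
move=> hx hy.
have [hx1 hx2] : homog1 p x.1 /\ homog1 p x.2 by split=> b /hx[].
have [hy1 hy2] : homog1 q y.1 /\ homog1 q y.2 by split=> b /hy[].
have FD s z : {morph factor_rep s z : u w / u + w}.
  by move=> u w; rewrite -[u in LHS]scale1r factor_rep_linear scale1r.
rewrite /pair_rep !FD !(factor_rep_br _ _ hx1 hy1) !(factor_rep_br _ _ hx2 hy2).
(* All mixed terms are put in the order with the second factor outermost; the sign this creates on
   the right-hand side meets an equal one and squares to 1. *)
rewrite (factor_rep_cross _ hx1 hy2) (factor_rep_cross _ hy1 hx2).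
rewrite !scalerDr scalerA [q && p]andbC -expr2 sqrr_sign scale1r.
by rewrite [LHS](AC (3*(1*2)) ((1*5)*((2*4)*(3*6))))%AC.
Qed.

End BasisAction.

(** * Verma modules of osp(1|2) and their tensor product *)

Section Verma.
Variables (K : numFieldType) (a : K).

(** The scalar in [x_alpha x_-alpha^n v = eps n x_-alpha^(n-1) v]. The recursion [epsS] is
    [x_alpha x_-alpha = h - x_-alpha x_alpha], with [h] acting on [x_-alpha^n v] by [a + n]. *)
Definition eps (n : nat) : K := (if odd n then a else 0) + n./2%:R.

Lemma epsS n : eps n.+1 = a + n%:R - eps n.
Proof.
have nE : n%:R = (odd n)%:R + n./2%:R * 2 :> K.
  by rewrite -natrM muln2 -natrD odd_double_half.
rewrite nE /eps /= uphalf_half natrD.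
by case: (odd n) => /=; ring.
Qed.
Lemma eps0 : eps 0 = 0. Proof. by rewrite /eps addr0. Qed.

(* The Verma module on a vector v with x_alpha v = 0 and h v = a v, in the basis
   x_{-alpha}^n v: the n-th coordinate of x_b f is
   [verma_coef b n * f (verma_shift b n)]. *)
Definition verma_coef (b : osp_basis) (n : nat) : K :=
  match b with
  | xm2 => (1 < n)%:R | xm1 => (0 < n)%:R | xh => a + n%:R
  | xp1 => eps n.+1 | xp2 => - (eps n.+1 * eps n.+2)
  end.
Definition verma_shift (b : osp_basis) (n : nat) : nat :=
  match b with xm2 => n.-2 | xm1 => n.-1 | xh => n | xp1 => n.+1 | xp2 => n.+2 end.

(** Coordinate functions are arbitrary, so this is the completed Verma module; an output coordinate
    depends on a single input coordinate, hence infinite sums never arise. *)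
Definition verma_op (b : osp_basis) (f : nat -> K) (n : nat) : K :=
  verma_coef b n * f (verma_shift b n).

(** The bracket table transcribed to operators coordinatewise, which reduces each relation to a ring
    identity in [K]. *)
Definition verma_br (b c : osp_basis) (f : nat -> K) (n : nat) : K :=
  match b, c with
  | xh, c => (- weight c)%:~R * verma_op c f n
  | b, xh => (weight b)%:~R * verma_op b f n
  | xp1, xp1 => (- 2) * verma_op xp2 f n
  | xm1, xm1 => 2 * verma_op xm2 f n
  | xp1, xm2 => verma_op xm1 f n
  | xm2, xp1 => - verma_op xm1 f n
  | xm1, xp2 => verma_op xp1 f n
  | xp2, xm1 => - verma_op xp1 f n
  | xp1, xm1 | xm1, xp1 => verma_op xh f n
  | xm2, xp2 => verma_op xh f n
  | xp2, xm2 => - verma_op xh f n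
  | _, _ => 0
  end.

Lemma verma_opC b c f n :
  verma_op b (verma_op c f) n = verma_br b c f n
    + (-1) ^+ (odd_basis b && odd_basis c) * verma_op c (verma_op b f) n.
Proof.
case: b; case: c; rewrite /verma_br /verma_op /=;
  (* The indices 0 and 1 are separate because [verma_shift] truncates there. *)
  case: n => [|[|n]]; rewrite /= ?(epsS, eps0); ring.
Qed.

End Verma.

Section Tensor.
Variables (K : numFieldType) (a b : K).
Local Notation V := (nat * nat -> K^o).
Local Notation e c := (osp_e K c).

(** The sign is the Koszul sign for moving an element of the second factor past the first tensor
    component, whose parity is that of its index. *)
Definition tensor_op (s : bool) (c : osp_basis) (f : V) : V := fun nm =>
  if s then (-1) ^+ (odd nm.1 && odd_basis c) *
    verma_op b c (fun m => f (nm.1, m)) nm.2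
  else verma_op a c (fun n => f (n, nm.2)) nm.1.

Let addE (f g : V) nm : (f + g) nm = f nm + g nm :> K. Proof. by []. Qed.
Let scaleE (x : K) (f : V) nm : (x *: f) nm = x * f nm :> K. Proof. by []. Qed.
Let oppE (f : V) nm : (- f) nm = - f nm :> K. Proof. by []. Qed.
Let zeroE nm : (0 : V) nm = 0 :> K. Proof. by []. Qed.
Let VE := (addE, scaleE, oppE, zeroE).

Lemma tensor_op_linear s c : linear (tensor_op s c).
Proof.
move=> x f g; apply/funext => nm; rewrite VE.
by rewrite /tensor_op /verma_op !VE; case: s; ring.
Qed.

Lemma factor_rep_verma s x y (f : V) nm :
  factor_rep tensor_op s (osp_br_basis K x y) f nm =
  if s then (-1) ^+ (odd nm.1 && (odd_basis x (+) odd_basis y)) *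
    verma_br b x y (fun m => f (nm.1, m)) nm.2
  else verma_br a x y (fun n => f (n, nm.2)) nm.1.
Proof.
case: s; case: x; case: y; rewrite /= !factor_repE ?VE /tensor_op /=;
  by rewrite ?andbF ?mulr0 ?mul1r //; ring.
Qed.

Lemma tensor_op_br s x y (f : V) : tensor_op s x (tensor_op s y f) =
  factor_rep tensor_op s (osp_br_basis K x y) f
  + (-1) ^+ (odd_basis x && odd_basis y) *: tensor_op s y (tensor_op s x f).
Proof.
apply/funext => nm; rewrite !VE factor_rep_verma.
case: s; last exact: verma_opC.
have E u v : tensor_op true u (tensor_op true v f) nm =
    (-1) ^+ (odd nm.1 && (odd_basis u (+) odd_basis v)) *
    verma_op b u (verma_op b v (fun m => f (nm.1, m))) nm.2.
  rewrite /tensor_op /= /verma_op.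
  by case: (odd nm.1); case: (odd_basis u); case: (odd_basis v) => /=; ring.
by rewrite !E verma_opC mulrDr [odd_basis y (+) _]addbC mulrCA.
Qed.

(** Truncation of the shift happens only where the coefficient is 0. This controls how the Koszul
    sign changes under the first factor. *)
Lemma verma_coef_parity c n : verma_coef a c n = 0 \/
  odd (verma_shift c n) = odd n (+) odd_basis c.
Proof.
by case: c; case: n => [|[|n]] /=; rewrite ?negbK ?addbF ?addbT ?negbK; auto.
Qed.

Lemma tensor_op_cross x y (f : V) : tensor_op false x (tensor_op true y f) =
  (-1) ^+ (odd_basis x && odd_basis y) *: tensor_op true y (tensor_op false x f).
Proof.
apply/funext => -[n m]; rewrite !VE /tensor_op /verma_op /=.
have [->|->] := verma_coef_parity x n; first by rewrite !mul0r !mulr0.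
by case: (odd n); case: (odd_basis x); case: (odd_basis y) => /=; ring.
Qed.

Hypothesis ab : forall n : int, a + b != n%:~R.

(** [H - n] is diagonal with entries [a + b + k + l - n], all nonzero because [a + b] is not an
    integer. *)
Lemma verma_tensor_action : exists act : Uloc K -> V -> V, [/\ is_action act,
  forall c, act (Xdiag K c) =1 fun f => tensor_op false c f + tensor_op true c f &
  forall c, act (Xtilde K c) =1 fun f => tensor_op false c f - tensor_op true c f].
Proof.
have HE (f : V) (n : int) nm : (pair_rep tensor_op (e xh, e xh) f - n%:~R *: f) nm =
    (a + b + nm.1%:R + nm.2%:R - n%:~R) * f nm.
  case: nm => k l; rewrite /pair_rep !factor_rep_e !VE /tensor_op /verma_op /=.
  by rewrite andbF; ring.
have [|||n|act actP actE] := @Uloc_action K V (pair_rep tensor_op).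
- exact/pair_rep_linear/tensor_op_linear.
- exact: pair_rep_linl.
- move=> p q x y v; apply: pair_rep_br.
  + exact: tensor_op_linear.
  + exact: tensor_op_br.
  + exact: tensor_op_cross.
- have nz (nm : nat * nat) : a + b + nm.1%:R + nm.2%:R - n%:~R != 0.
    have -> : a + b + nm.1%:R + nm.2%:R - n%:~R = a + b - (n - nm.1%:Z - nm.2%:Z)%:~R.
      by rewrite !rmorphB /= -!pmulrn; ring.
    by rewrite subr_eq0.
  exists (fun f nm => (a + b + nm.1%:R + nm.2%:R - n%:~R)^-1 * f nm) => f;
    apply/funext => nm.
    by rewrite HE mulKf.
  by rewrite HE mulVKf.
exists act; split=> // c f; rewrite [LHS]actE /pair_rep /=.
  by rewrite !factor_rep_e.
by rewrite factor_repN !factor_rep_e.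
Qed.

End Tensor.

(** * Vectors and functionals detecting elements outside [J] *)

Section Functionals.
Variables (K : numFieldType) (a b : K).
Hypothesis ab : forall n : int, a + b != n%:~R.
Local Notation U := (Uloc K).
Local Notation h := (Hdiag K).
Local Notation x c := (Xtilde K c).
Local Notation V := (nat * nat -> K^o).

Definition hw_vector : V := fun nm => if nm is (0, 0)%N then 1 else 0.
(** The coefficients are chosen so that [X_alpha] kills this vector in degree 2: the contributions
    at [(1, 0)] are [b - b], and at [(0, 1)] they are [a - a]. *)
Definition singular_vector : V := fun nm =>
  match nm with (2, 0)%N => b | (1, 1)%N => 1 | (0, 2)%N => - a | _ => 0 end.

Let addE (f g : V) nm : (f + g) nm = f nm + g nm :> K. Proof. by []. Qed.
Let scaleE (y : K) (f : V) nm : (y *: f) nm = y * f nm :> K. Proof. by []. Qed.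
Let oppE (f : V) nm : (- f) nm = - f nm :> K. Proof. by []. Qed.
Let zeroE nm : (0 : V) nm = 0 :> K. Proof. by []. Qed.
Let VE := (addE, scaleE, oppE, zeroE).

(** [L u] is the [(0, 0)] coordinate of [u] applied to the highest weight vector, a Harish-Chandra
    projection evaluated at the weights. The image of [X_-alpha] has zero coordinate there, and all
    positive root vectors kill the highest weight vector. *)
Lemma hc_functional : exists L : U -> K,
  [/\ forall u v, L (u + v) = L u + L v,
      forall k u, L (k *: u) = k * L u,
      forall u, inJ u -> L u = 0,
      forall u, L (u * x xp1) = 0 /\ L (u * x xp2) = 0
    & L (h * h) = (a + b) ^+ 2 /\ L (x xh * x xh) = (a - b) ^+ 2].
Proof.
have [act [actP actX actY]] := verma_tensor_action ab.
have v0 c s : c \in [:: xp1; xp2] -> tensor_op a b s c hw_vector = 0.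
  rewrite !inE => /orP[]/eqP->; apply/funext => -[n m]; case: s;
    rewrite /tensor_op /verma_op /=; case: n m => [|n] [|m]; by rewrite ?mulr0.
have hE s : tensor_op a b s xh hw_vector = (if s then b else a) *: hw_vector.
  apply/funext => -[n m]; rewrite VE /tensor_op /verma_op /=.
  by case: s; case: n m => [|n] [|m]; rewrite ?andbF /=; ring.
exists (fun u => act u hw_vector (0, 0)%N); split.
- by move=> u v; rewrite (actD actP).
- by move=> k u; rewrite (actZ actP).
- move=> u /inJP[y [z ->]]; rewrite (actD actP) !(actM actP) !actX !v0 ?inE //.
  rewrite addr0 (act0 actP) addr0 !VE /tensor_op /verma_op /=.
  by rewrite !mul0r mulr0 addr0.
- by move=> u; rewrite !(actM actP) !actY !v0 ?inE // subrr (act0 actP).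
have aX : act h hw_vector = (a + b) *: hw_vector by rewrite actX !hE -scalerDl.
have aY : act (x xh) hw_vector = (a - b) *: hw_vector.
  by rewrite actY !hE -scalerBl.
by rewrite !(actM actP) aX aY !(act_scale actP) aX aY !VE /= !mulr1.
Qed.

(** On the singular vector an element of [J] has zero [(0, 0)] coordinate. There [x xp2] contributes
    [- 2 a b] and [x xh] contributes [a - b]. *)
Lemma tilde_p2_notJ : a != 0 -> b != 0 -> a != b -> ~ inJ (x xh * x xp2).
Proof.
move=> a0 b0 anb /inJP[y [z E]].
have [act [actP actX actY]] := verma_tensor_action ab.
have v0 : act (Xdiag K xp1) singular_vector = 0.
  rewrite actX; apply/funext => -[n m]; rewrite !VE /tensor_op /verma_op /= !epsS.
  by case: n m => [|[|[|n]]] [|[|[|m]]]; rewrite /= ?epsS ?eps0; ring.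
have /(congr1 (fun f : V => f (0, 0)%N)) : act (x xh * x xp2) singular_vector =
    act (Xdiag K xm1 * y + z * Xdiag K xp1) singular_vector by rewrite E.
rewrite (actD actP) !(actM actP) v0 (act0 actP) addr0 !actY actX.
rewrite !VE /tensor_op /verma_op /= !VE /= !epsS !eps0.
move/eqP; rewrite -subr_eq0; set t := (X in X == 0).
have -> : t = - 2 * (a * b * (a - b)) by rewrite /t; ring.
by rewrite !mulf_eq0 oppr_eq0 pnatr_eq0 (negPf a0) (negPf b0) subr_eq0 (negPf anb).
Qed.

Lemma tilde_m2_notJ : a != b -> ~ inJ (x xm2 * x xh).
Proof.
move=> anb /inJP[y [z E]].
have [act [actP actX actY]] := verma_tensor_action ab.
have v0 : act (Xdiag K xp1) hw_vector = 0.
  rewrite actX; apply/funext => -[n m]; rewrite !VE /tensor_op /verma_op /=.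
  by case: n m => [|n] [|m]; rewrite /=; ring.
(* This functional kills the image of [X_-alpha], which in degree 2 is spanned by [(2,0) - (1,1)]
   and [(1,1) + (0,2)]. *)
pose l (f : V) : K := f (2, 0)%N + f (1, 1)%N - f (0, 2)%N.
have : l (act (x xm2 * x xh) hw_vector) =
    l (act (Xdiag K xm1 * y + z * Xdiag K xp1) hw_vector) by rewrite E.
rewrite (actD actP) !(actM actP) v0 (act0 actP) addr0 !actY actX.
rewrite /l !VE /tensor_op /verma_op /= !VE /=.
move/eqP; rewrite -subr_eq0; set t := (X in X == 0).
have -> : t = 2 * (a - b) by rewrite /t; ring.
by rewrite mulf_eq0 pnatr_eq0 subr_eq0 (negPf anb).
Qed.

End Functionals.

(** * Three relations of the reduction algebra *)

Section Relations.
Variable K : numFieldType.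
Local Notation U := (Uloc K).
Local Notation A := (dra K).
Local Notation xp := (Xdiag K xp1).
Local Notation xm := (Xdiag K xm1).
Local Notation h := (Hdiag K).
Local Notation x c := (Xtilde K c).
Local Notation Hi := (Hinv K 0).

Lemma dra_piN (u : U) : dra_pi (- u) = - dra_pi u.
Proof. by rewrite -[- u]scaleN1r [LHS]dra_piZ -[RHS]scaleN1r. Qed.
Lemma dra_pi_l (u : U) : dra_pi (xm * u) = 0.
Proof. exact/dra_pi_eq0/inJ_l. Qed.
Lemma dra_pi_r (u : U) : dra_pi (u * xp) = 0.
Proof. exact/dra_pi_eq0/inJ_r. Qed.

(** [P] describes what the terms of index at least 2 are neglected modulo: equality with 0, or the
    left ideal [Lft]. *)
Lemma dra_mul_cut (P : A -> Prop) (u v : U) : P 0 ->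
  (forall a b, P a -> P b -> P (a + b)) ->
  (forall n, P (dra_pi (diamond_term u v n.+2))) ->
  exists2 r, P r & dra_pi u * dra_pi v =
    dra_pi (u * v) - dra_pi (u * xm * Hi * xp * v) + r.
Proof.
move=> P0 PD Pn; have [N hN] := diamond_term_l u.
exists (\sum_(n < N) dra_pi (diamond_term u v n.+2)); first exact: big_ind.
rewrite dra_mulE (@diamond_repE _ _ _ N.+2) => [|n /ltnW/ltnW]; last exact: hN.
rewrite (big_morph (@dra_pi K) (@dra_piD K) (@dra_pi0 K)) !big_ord_recl addrA.
congr (_ + _ + _).
  by rewrite /diamond_term /= !mulr1.
rewrite -dra_piN /diamond_term /= mulr1; congr dra_pi.
(* Passing [X_-alpha] turns the denominator [H - 1] of [phi_1] into [H]. *)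
have E : Hinv K 1 * xm = xm * Hi.
  have [_ E2] := HinvP K 1; have [E1 _] := HinvP K 0.
  rewrite -[LHS]mulr1 -E1 mulrA -[_ * xm * _]mulrA -(xm_shift K 1) !mulrA E2 mul1r.
  by [].
by rewrite !expr1 mulrN !mulNr -[u * _ * xm]mulrA E !mulrA.
Qed.

Lemma dra_mul_cut0 (u v : U) : (forall n, dra_pi (diamond_term u v n.+2) = 0) ->
  dra_pi u * dra_pi v = dra_pi (u * v) - dra_pi (u * xm * Hi * xp * v).
Proof.
move=> Pn; have [a b -> ->|r -> ->] := @dra_mul_cut (eq^~ 0) u v erefl _ Pn.
  by rewrite addr0.
by rewrite addr0.
Qed.

Lemma dra_mul_weight0_l (u v w : U) : u * xm = xm * w ->
  dra_pi u * dra_pi v = dra_pi (u * v).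
Proof.
move=> uw; have [N ->] := dra_mul_expand u v.
rewrite big1 ?addr0 // => n _.
have [f E] := phi_xm K n.+1.
by rewrite -[u * _ * _]mulrA E exprS !mulrA uw -!mulrA dra_pi_l.
Qed.

(* [x_a, x_b] on the antidiagonal lands back in the diagonal subalgebra. *)
Lemma tilde_comm a b : x a * x b = Uin (osp_br_basis K a b, osp_br_basis K a b) +
  (-1) ^+ (odd_basis a && odd_basis b) *: (x b * x a).
Proof.
have hx c : osp2_homog (odd_basis c) ((osp_e K c, - osp_e K c) : osp2 K).
  by have := @homog_e K c 1 (-1); rewrite scale1r scaleN1r.
rewrite [LHS](UinC (hx a) (hx b)) /osp2_br /= osp_br_e; congr (Uin (_, _) + _).
rewrite -[- osp_e K a]scaleN1r -[- osp_e K b]scaleN1r -osp_br_e /osp_br.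
apply: eq_bigr => i _; apply: eq_bigr => j _; congr (_ *: _).
by rewrite !ffunE !scaleN1r mulrNN.
Qed.

Lemma xp_tilde_p1 : xp * x xp1 = - (2 *: x xp2) - x xp1 * xp.
Proof. by rewrite X_tilde /= UinZtilde scaleNr expr1 scaleN1r. Qed.
Lemma xp_tilde_p2 : xp * x xp2 = x xp2 * xp.
Proof. by rewrite X_tilde /= Uin_tilde0 add0r scale1r. Qed.
Lemma xp2_tilde_p1 : xp * (xp * x xp1) = x xp1 * xp * xp.
Proof.
rewrite {1}xp_tilde_p1 mulrBr mulrN -presented_scaleAr xp_tilde_p2 mulrA xp_tilde_p1.
by rewrite mulrBl mulNr -presented_scaleAl opprD !opprK addKr.
Qed.
Lemma xp_tilde_h : xp * x xh = x xp1 + x xh * xp.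
Proof. by rewrite X_tilde /= UinZtilde !scale1r. Qed.
Lemma xp_tilde_m1 : xp * x xm1 = x xh - x xm1 * xp.
Proof. by rewrite X_tilde /= expr1 scaleN1r. Qed.
Lemma tilde_p1_xm : x xp1 * xm = x xh - xm * x xp1.
Proof.
by rewrite (X_tilde K xm1 xp1) /= expr1 scaleN1r opprD opprK addrA subrr add0r.
Qed.
Lemma tilde_m1_xm : x xm1 * xm = 2 *: x xm2 - xm * x xm1.
Proof.
rewrite (X_tilde K xm1 xm1) /= expr1 scaleN1r UinZtilde.
by rewrite opprD opprK addrA subrr add0r.
Qed.
Lemma tilde_m2_xm : x xm2 * xm = xm * x xm2.
Proof. by rewrite (X_tilde K xm1 xm2) /= Uin_tilde0 add0r scale1r. Qed.
Lemma tilde_h_comm : h * x xh = x xh * h.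
Proof. by rewrite (X_tilde K xh xh) /= UinZtilde scale0r add0r scale1r. Qed.

Lemma tilde_sqr a (c : osp_basis) (k : K) : odd_basis a ->
  osp_br_basis K a a = (k *+ 2) *: osp_e K c -> x a * x a = k *: Xdiag K c.
Proof.
move=> oa E; have := tilde_comm a a; rewrite oa E /= expr1 scaleN1r UinZd.
move=> E2; have : x a * x a *+ 2 = (k *+ 2) *: Xdiag K c by rewrite mulr2n {1}E2 subrK.
rewrite -[in LHS]scaler_nat -[k *+ 2]mulr_natl.
move/(congr1 (fun v => (2^-1 : K) *: v)).
by rewrite !scalerA mulKf ?pnatr_eq0 // mulVf ?pnatr_eq0 // scale1r.
Qed.

Lemma h_Hinv : h * Hi = 1.
Proof. by have [] := HinvP K 0; rewrite subr0. Qed.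
Lemma Hinv_h : Hi * h = 1.
Proof. by have [] := HinvP K 0; rewrite subr0. Qed.

Lemma Hbar_mull (u : U) : Hbar K * dra_pi u = dra_pi (h * u).
Proof.
apply: (@dra_mul_weight0_l h u (h - (0 - 1)%:~R)).
by rewrite -{1}[h]subr0 (xm_shift K 0).
Qed.
Lemma Hbar_mulr (u : U) : dra_pi u * Hbar K = dra_pi (u * h).
Proof.
apply: (@dra_mul_weight0 K u h (h - (0 - 1)%:~R)).
by rewrite -{1}[h]subr0 (xp_shift K 0).
Qed.

(** The square of [x xp1] in [U] is the square of [X_alpha], hence in [J], and [X_alpha^2] commutes
    with [x xp1], so only the term of index 1 survives; multiplying by [H] clears its
    denominator. *)
Lemma xbar_p1_sqr :
  Hbar K * (xbar K xp1 * xbar K xp1) = 2 *: (xbar K xh * xbar K xp2).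
Proof.
have -> : xbar K xh * xbar K xp2 = dra_pi (x xh * x xp2).
  exact: (dra_mul_weight0 _ xp_tilde_p2).
rewrite [xbar K xp1 * _]dra_mul_cut0 => [|n].
  rewrite (@tilde_sqr xp1 xp2 (-1)) ?mulNrn // X_p2 scaleN1r opprK dra_pi_r sub0r.
  rewrite -mulrA xp_tilde_p1 tilde_p1_xm.
  rewrite mulrBr dra_piD [_ * (_ * xp)]mulrA dra_piN dra_pi_r.
  rewrite subr0 [_ * Hi * - _]mulrN dra_piN opprK.
  rewrite !mulrBl dra_piD -!mulrA dra_piN dra_pi_l subr0 Hbar_mull.
  rewrite -!presented_scaleAr [LHS]dra_piZ; congr (_ *: dra_pi _).
  by rewrite !mulrA tilde_h_comm -(mulrA (x xh)) h_Hinv mulr1.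
by rewrite /diamond_term !exprSr -!mulrA xp2_tilde_p1 !mulrA dra_pi_r.
Qed.

Lemma xbar_m1_sqr :
  xbar K xm1 * xbar K xm1 * Hbar K = - (2 *: (xbar K xm2 * xbar K xh)).
Proof.
have -> : xbar K xm2 * xbar K xh = dra_pi (x xm2 * x xh).
  exact: (dra_mul_weight0_l _ tilde_m2_xm).
rewrite [xbar K xm1 * _]dra_mul_cut0 => [|n].
  rewrite (@tilde_sqr xm1 xm2 1) // X_m2 scale1r dra_pi_l sub0r.
  rewrite -mulrA xp_tilde_m1 tilde_m1_xm.
  rewrite mulrBr dra_piD [_ * (_ * xp)]mulrA dra_piN dra_pi_r subr0.
  rewrite !mulrBl dra_piD -!mulrA dra_piN dra_pi_l subr0 -dra_piN Hbar_mulr.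
  rewrite mulNr dra_piN -!presented_scaleAl [X in - X]dra_piZ.
  congr (- (_ *: dra_pi _)).
  by rewrite -!mulrA -tilde_h_comm [Hi * _]mulrA Hinv_h mul1r.
have [f E] := phi_xm K n.+2.
rewrite /diamond_term -[x xm1 * _ * _]mulrA E 2!exprS !mulrA tilde_m1_xm.
rewrite mulrBl -presented_scaleAl tilde_m2_xm presented_scaleAr -[xm * _ * xm]mulrA.
by rewrite -mulrBr -!mulrA dra_pi_l.
Qed.

(** As a left ideal generated by rescaled elements, it is mapped into itself by every rescaling
    automorphism. *)
Definition Lft (r : A) := exists a b, r = a * xbar K xp1 + b * xbar K xp2.

Lemma Lft0 : Lft 0.
Proof. by exists 0, 0; rewrite !mul0r addr0. Qed.
Lemma LftD r s : Lft r -> Lft s -> Lft (r + s).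
Proof.
move=> [a [b ->]] [c [d ->]]; exists (a + c), (b + d).
by rewrite !mulrDl addrACA.
Qed.
Lemma LftM c r : Lft r -> Lft (c * r).
Proof.
by move=> [a [b ->]]; exists (c * a), (c * b); rewrite mulrDr !mulrA.
Qed.
Lemma LftZ (c : K) r : Lft r -> Lft (c *: r).
Proof. by move/(LftM (c *: (1 : A))); rewrite -dra_scalerAl mul1r. Qed.
Lemma LftN r : Lft r -> Lft (- r).
Proof. by rewrite -scaleN1r; apply: LftZ. Qed.

Lemma xbar_p2_mulr u : dra_pi u * xbar K xp2 = dra_pi (u * x xp2).
Proof. exact: (dra_mul_weight0 _ xp_tilde_p2). Qed.

Lemma xbar_p1_mulr u : dra_pi u * xbar K xp1 =
  dra_pi (u * x xp1 + 2 *: (u * xm * Hi * x xp2)).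
Proof.
rewrite [LHS]dra_mul_cut0 => [|n].
  rewrite dra_piD -[_ * xp * _]mulrA xp_tilde_p1 mulrBr [_ * (_ * xp)]mulrA.
  rewrite [in LHS]dra_piD dra_piN dra_pi_r subr0 mulrN dra_piN opprK.
  by rewrite -presented_scaleAr.
by rewrite /diamond_term !exprSr -!mulrA xp2_tilde_p1 !mulrA dra_pi_r.
Qed.

(** Turns the left ideal for the diamond product into one for the product of [U], where
    [hc_functional] applies. *)
Lemma Lft_rep r : Lft r -> exists u v, r = dra_pi (u * x xp1 + v * x xp2).
Proof.
move=> [a [b ->]]; elim/dra_pi_ind: a => u; elim/dra_pi_ind: b => v.
exists u, ((2 : K) *: (u * xm * Hi) + v).
rewrite xbar_p2_mulr xbar_p1_mulr -dra_piD mulrDl -presented_scaleAl.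
by rewrite addrA.
Qed.

Lemma Lft_p2 u : Lft (dra_pi (u * x xp2)).
Proof. by exists 0, (dra_pi u); rewrite mul0r add0r xbar_p2_mulr. Qed.

Lemma Lft_p1 u : Lft (dra_pi (u * x xp1)).
Proof.
have E := xbar_p1_mulr u; rewrite dra_piD [X in _ = _ + X]dra_piZ in E.
rewrite (canRL (addrK _) (esym E)); apply/LftD/LftN/LftZ/Lft_p2.
by exists (dra_pi u), 0; rewrite mul0r addr0.
Qed.

(** A left ideal of [U] lying over [Lft]; the summand [r * xp] is already in [J]. *)
Definition Lid (u : U) := exists p q r, u = p * x xp1 + q * x xp2 + r * xp.

Lemma LidM u v : Lid v -> Lid (u * v).
Proof.
by move=> [p [q [r ->]]]; exists (u * p), (u * q), (u * r); rewrite !mulrDr !mulrA.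
Qed.

Lemma Lft_pi u : Lid u -> Lft (dra_pi u).
Proof.
move=> [p [q [r ->]]]; rewrite !dra_piD dra_pi_r addr0.
by apply: LftD; [exact: Lft_p1|exact: Lft_p2].
Qed.

Lemma dra_mul_cutL (u v : U) : Lid (xp * xp * v) -> exists2 r, Lft r &
  dra_pi u * dra_pi v = dra_pi (u * v) - dra_pi (u * xm * Hi * xp * v) + r.
Proof.
move=> Lv; apply: dra_mul_cut => [|a b|n]; [exact: Lft0|exact: LftD|].
rewrite /diamond_term [xp ^+ _.+2]exprSr [xp ^+ _.+1]exprSr.
by rewrite -mulrA; apply: Lft_pi; apply: LidM; rewrite -2!mulrA; apply: LidM; rewrite mulrA.
Qed.

Lemma xbar_h_sqr : exists2 r, Lft r &
  xbar K xh * xbar K xh = dra_pi (x xh * x xh) + r.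
Proof.
have [|r Lr E] := @dra_mul_cutL (x xh) (x xh).
  rewrite -mulrA xp_tilde_h; exists 0, ((- 2 : K) *: (1 : U)), (xp * x xh - x xp1).
  rewrite mulrDr xp_tilde_p1 mul0r add0r -presented_scaleAl mul1r scaleNr mulrBl.
  by rewrite mulrA addrA addrAC.
exists (- dra_pi (x xh * xm * Hi * xp * x xh) + r); last by rewrite addrA -E.
apply/LftD => //; apply/LftN.
rewrite -mulrA xp_tilde_h mulrDr mulrA dra_piD dra_pi_r addr0.
exact: Lft_p1.
Qed.

(** The term of index 0 gives [H] up to [Lft], because antidiagonal elements bracket into the
    diagonal; the term of index 1 gives [- x xh * H^-1 * x xh]. *)
Lemma xbar_p1_m1 : exists2 r, Lft r & Hbar K * (xbar K xp1 * xbar K xm1) =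
  Hbar K * Hbar K - xbar K xh * xbar K xh + r.
Proof.
have [|r Lr E] := @dra_mul_cutL (x xp1) (x xm1).
  rewrite -mulrA xp_tilde_m1 mulrBr xp_tilde_h; exists 1, 0, (x xh - xp * x xm1).
  by rewrite mul0r addr0 mul1r mulrBl -!mulrA addrA.
have [s Ls E'] := xbar_h_sqr.
exists (s - Hbar K * dra_pi (x xm1 * x xp1) + Hbar K * r).
  by apply: LftD; [apply: LftD => //; apply/LftN/LftM/Lft_p1|apply: LftM].
have E1 : dra_pi (x xp1 * x xm1) = Hbar K - dra_pi (x xm1 * x xp1).
  rewrite tilde_comm /= expr1 scaleN1r -/(Xdiag K xh).
  by rewrite dra_piD [in LHS]dra_piN.
have E2 : dra_pi (x xp1 * xm * Hi * xp * x xm1) = dra_pi (x xh * Hi * x xh).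
  rewrite -mulrA xp_tilde_m1 tilde_p1_xm mulrBr dra_piD [_ * (_ * xp)]mulrA dra_piN.
  by rewrite dra_pi_r subr0 !mulrBl dra_piD dra_piN -!mulrA dra_pi_l subr0.
have E3 : Hbar K * dra_pi (x xh * Hi * x xh) = dra_pi (x xh * x xh).
  by rewrite Hbar_mull !mulrA tilde_h_comm -(mulrA (x xh)) h_Hinv mulr1.
rewrite [xbar K xp1 * _]E E' E1 E2 mulrDr mulrBr E3 mulrBr.
by rewrite opprD !addrA; congr (_ + _); rewrite subrK addrAC.
Qed.

End Relations.

(** * Constraints on the scalars *)

Section Rescalings.
Variable K : numFieldType.
Local Notation A := (dra K).
Local Notation h := (Hdiag K).
Local Notation x c := (Xtilde K c).

Lemma half_not_int (n : int) : (2^-1 : K) != n%:~R.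
Proof.
apply/eqP => E; have : (n * 2)%:~R = 1%:~R :> K.
  by rewrite intrM -E mulVf ?pnatr_eq0.
by move/intr_inj/(congr1 (odd \o absz)); rewrite /= abszM oddM andbF.
Qed.

(** The weights 3/4 and -1/4 are nonzero, differ by 1 and have a non-integral sum, as the
    non-membership lemmas require. *)
Lemma three_quarters : (3 / 4 : K) + - 4^-1 = 2^-1. Proof. by field. Qed.

Lemma xbar_hp2_neq0 : xbar K xh * xbar K xp2 != 0.
Proof.
apply/eqP; rewrite [LHS](dra_mul_weight0 _ (xp_tilde_p2 K)) => /esym E.
have /tilde_p2_notJ : forall n : int, (3 / 4 : K) + - 4^-1 != n%:~R.
  by move=> n; rewrite three_quarters half_not_int.
apply.
- by rewrite mulf_neq0 ?invr_eq0 ?pnatr_eq0.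
- by rewrite oppr_eq0 invr_eq0 pnatr_eq0.
- rewrite -subr_eq0 (_ : _ - _ = 1) ?oner_eq0 //; by field.
by rewrite -[x xh * _]subr0; apply/dra_piP; rewrite -E dra_pi0.
Qed.

Lemma xbar_m2h_neq0 : xbar K xm2 * xbar K xh != 0.
Proof.
apply/eqP; rewrite [LHS](dra_mul_weight0_l _ (tilde_m2_xm K)) => /esym E.
have /tilde_m2_notJ : forall n : int, (3 / 4 : K) + - 4^-1 != n%:~R.
  by move=> n; rewrite three_quarters half_not_int.
apply; first by rewrite -subr_eq0 (_ : _ - _ = 1) ?oner_eq0 //; field.
by rewrite -[x xm2 * _]subr0; apply/dra_piP; rewrite -E dra_pi0.
Qed.

Lemma xbar_p1_neq0 : xbar K xp1 != 0.
Proof.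
apply/eqP => E; have := xbar_p1_sqr K; rewrite E mul0r mulr0 => /esym/eqP.
by rewrite scaler_eq0 pnatr_eq0 (negPf xbar_hp2_neq0).
Qed.
Lemma xbar_h_neq0 : xbar K xh != 0.
Proof. by apply/eqP => E; have := xbar_hp2_neq0; rewrite E mul0r eqxx. Qed.

Lemma dra_scaler_inj (a b : K) (z : A) : z != 0 -> a *: z = b *: z -> a = b.
Proof.
move=> z0 /eqP; rewrite -subr_eq0 -scalerBl scaler_eq0 (negPf z0) orbF subr_eq0.
by move/eqP.
Qed.

Lemma weight0_coef (a b : K) :
  Lft (a *: dra_pi (h * h) + b *: dra_pi (x xh * x xh)) -> a = 0 /\ b = 0.
Proof.
case/Lft_rep => u [v E].
have J : inJ (a *: (h * h) + b *: (x xh * x xh) - (u * x xp1 + v * x xp2)).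
  apply/dra_piP; rewrite -E dra_piD; congr (_ + _); exact: dra_piZ.
have coef c d : (forall n : int, c + d != n%:~R) ->
    a * (c + d) ^+ 2 + b * (c - d) ^+ 2 = 0 :> K.
  case/hc_functional => L [LD LZ LJ Ll [Lh Lx]]; have := LJ _ J.
  rewrite -scaleN1r !LD !LZ Lh Lx LD (Ll u).1 (Ll v).2 addr0 mulr0 addr0.
  by [].
(* Equal weights 1/4 make the difference vanish, which isolates the coefficient of [h * h]. *)
have E0 : a * 2^-1 ^+ 2 = 0.
  have := @coef (4^-1) (4^-1).
  rewrite subrr expr0n mulr0 addr0 (_ : 4^-1 + 4^-1 = 2^-1); last by field.
  by apply; apply: half_not_int.
have /eqP : a = 0.
  by apply/eqP; move/eqP: E0; rewrite mulf_eq0 expf_eq0 invr_eq0 pnatr_eq0 /= orbF.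
move/eqP=> a0; split=> //; have := @coef (3 / 4) (- 4^-1).
rewrite a0 mul0r add0r three_quarters (_ : 3 / 4 - - 4^-1 = 1); last by field.
by rewrite expr1n mulr1; apply; apply: half_not_int.
Qed.

Section Constraints.
Variables (tau : dra_aut K) (k : osp_basis -> K).
Hypothesis tx : forall b, tau (xbar K b) = k b *: xbar K b.
Hypothesis tH : tau (Hbar K) = Hbar K.

Let tM : {morph tau : a b / a * b}. Proof. by case: (dra_aut_monoid tau). Qed.
Let tD : {morph tau : a b / a + b}.
Proof. by move=> a b; have := dra_aut_linear tau 1 a b; rewrite !scale1r. Qed.
Let tN a : tau (- a) = - tau a.
Proof. by rewrite -[- a]scaleN1r dra_aut_scale scaleN1r. Qed.
Let txx b c : tau (xbar K b * xbar K c) = (k b * k c) *: (xbar K b * xbar K c).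
Proof. by rewrite tM !tx -dra_scalerAl -dra_scalerAr scalerA. Qed.
Let scale_inj2 (a b : K) (z : A) : z != 0 -> a *: (2 *: z) = b *: (2 *: z) -> a = b.
Proof. by move=> z0; apply: dra_scaler_inj; rewrite scaler_eq0 pnatr_eq0. Qed.

Lemma rescaling_p1_sqr : k xp1 * k xp1 = k xh * k xp2.
Proof.
apply: scale_inj2 xbar_hp2_neq0 _.
have -> : (k xh * k xp2) *: (2 *: (xbar K xh * xbar K xp2)) =
    2 *: tau (xbar K xh * xbar K xp2) by rewrite txx !scalerA mulrC.
by rewrite -dra_aut_scale -xbar_p1_sqr tM tH txx dra_scalerAr.
Qed.

Lemma rescaling_m1_sqr : k xm1 * k xm1 = k xm2 * k xh.
Proof.
apply: scale_inj2 xbar_m2h_neq0 _; apply: oppr_inj.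
have -> : (k xm2 * k xh) *: (2 *: (xbar K xm2 * xbar K xh)) =
    2 *: tau (xbar K xm2 * xbar K xh) by rewrite txx !scalerA mulrC.
by rewrite -scalerN -xbar_m1_sqr -dra_aut_scale -tN -xbar_m1_sqr tM tH txx;
  exact: dra_scalerAl.
Qed.

(** Applying [tau] to the third relation and subtracting [p] times that relation leaves
    [(p - 1) H H + (q - p) h h] in the left ideal; independence gives [p = 1] and [q = p]. *)
Lemma rescaling_weight0 : k xp1 * k xm1 = 1 /\ k xh * k xh = 1.
Proof.
have tL r : Lft r -> Lft (tau r).
  move=> [a [b ->]]; exists (k xp1 *: tau a), (k xp2 *: tau b).
  by rewrite tD !tM !tx -!dra_scalerAl -!dra_scalerAr.
have [r Lr E] := xbar_p1_m1 K; have [s Ls Es] := xbar_h_sqr K.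
have HE : Hbar K * Hbar K = dra_pi (h * h) by exact: Hbar_mull.
set p := k xp1 * k xm1; set q := k xh * k xh.
have F : p *: (dra_pi (h * h) - (dra_pi (x xh * x xh) + s) + r) =
    dra_pi (h * h) - q *: (dra_pi (x xh * x xh) + s) + tau r.
  rewrite -HE -Es -E dra_scalerAr -txx -{1}tH -tM E !tD tN tM tH txx.
  by [].
have : Lft ((p - 1) *: dra_pi (h * h) + (q - p) *: dra_pi (x xh * x xh)).
  have -> : (p - 1) *: dra_pi (h * h) + (q - p) *: dra_pi (x xh * x xh) =
      tau r - p *: r - (q - p) *: s.
    have zl (P1 D1 P2 Ps Pr Q2 Qs : A) : P1 - D1 + (Q2 - P2) =
        P1 - (P2 + Ps) + Pr - (D1 - (Q2 + Qs)) - Pr - (Qs - Ps).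
      rewrite !opprB opprD [RHS](AC ((((1*2)*1)*3)*1*2)
        (((1*7)*(5*2))*((4*8)*((9*3)*(6*10)))))%AC /=.
      by rewrite !subrr !addr0.
    have -> : tau r = p *: (dra_pi (h * h) - (dra_pi (x xh * x xh) + s) + r) -
        (dra_pi (h * h) - q *: (dra_pi (x xh * x xh) + s)).
      by rewrite F addrAC subrr add0r.
    by rewrite !scalerBl scale1r !scalerDr scalerN !scalerDr -zl.
  apply: LftD; first by apply: LftD; [exact: tL|exact/LftN/LftZ].
  exact/LftN/LftZ.
case/weight0_coef => /eqP; rewrite subr_eq0 => /eqP p1 /eqP.
by rewrite subr_eq0 p1 => /eqP.
Qed.

Lemma rescaling_scalars : exists eps xi : K,
  (eps = 1 \/ eps = -1) /\ xi != 0 /\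
  [/\ k xh = eps, k xp1 = xi, k xm1 = xi^-1,
      k xp2 = eps * xi ^+ 2 & k xm2 = eps * xi ^- 2].
Proof.
have [p1 q1] := rescaling_weight0.
have xi0 : k xp1 != 0.
  by apply/eqP => E; move/eqP: p1; rewrite E mul0r eq_sym oner_eq0.
have m1E : k xm1 = (k xp1)^-1 by rewrite -[LHS](mulKf xi0) p1 mulr1.
exists (k xh), (k xp1); split; last split=> //; last split=> //.
- have /eqP : k xh ^+ 2 = 1 by rewrite expr2.
  by rewrite sqrf_eq1 => /orP[]/eqP; auto.
- by rewrite expr2 rescaling_p1_sqr mulrA q1 mul1r.
- by rewrite -exprVn -m1E expr2 rescaling_m1_sqr mulrCA q1 mulr1.
Qed.

End Constraints.

End Rescalings.

(** * The group of rescalings *)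

Section RescalingGroup.
Variable K : numFieldType.

Lemma twist_aut_rescaling s xi : is_rescaling (twist_aut (K := K) s xi).
Proof.
apply/asboolP; exists (fun b => (-1) ^+ s * val xi ^ weight b).
by split=> [b|]; [exact: twist_aut_xbar|exact: twist_aut_Hbar].
Qed.

(** The coordinate in [unit_group K] is the torus parameter, not the scalar on [xbar xp1]: the two
    differ by the sign when the factors are exchanged. *)
Definition twist_rescaling (u : 'Z_2 * unit_group K) : rescaling_group K :=
  exist _ (twist_aut (u.1 == 1) u.2) (twist_aut_rescaling (u.1 == 1) u.2).

Lemma twist_rescalingM : {morph twist_rescaling : u v / (u * v)%g}.
Proof.
move=> [s xi] [t zt]; apply: val_inj; rewrite /= -twist_aut_mul.
congr (twist_aut _ _).
by case: s => [[|[|//]] ?]; case: t => [[|[|//]] ?].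
Qed.

HB.instance Definition _ := isMultiplicative.Build _ _ twist_rescaling twist_rescalingM.

(** The scalar on [xbar xh], of weight 0, reveals the sign; the one on [xbar xp1] then reveals the
    torus parameter. *)
Lemma twist_aut_inj s t (xi zt : unit_group K) :
  twist_aut s xi = twist_aut t zt -> s = t /\ xi = zt.
Proof.
move=> E.
have /dra_scaler_inj-/(_ (xbar_h_neq0 K)) :
    ((-1) ^+ s * val xi ^ weight xh) *: xbar K xh =
    ((-1) ^+ t * val zt ^ weight xh) *: xbar K xh.
  by rewrite -!twist_aut_xbar E.
have /dra_scaler_inj-/(_ (xbar_p1_neq0 K)) :
    ((-1) ^+ s * val xi ^ weight xp1) *: xbar K xp1 =
    ((-1) ^+ t * val zt ^ weight xp1) *: xbar K xp1.
  by rewrite -!twist_aut_xbar E.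
rewrite /= !expr0z !expr1z !mulr1 => E1 E2.
have st : s = t.
  case: s t E2 {E E1} => [] [] //= /eqP; rewrite ?expr0 ?expr1.
    by rewrite -subr_eq0 -opprD oppr_eq0 -mulr2n pnatr_eq0.
  by rewrite eq_sym -subr_eq0 -opprD oppr_eq0 -mulr2n pnatr_eq0.
split=> //; apply: val_inj; move: E1; rewrite st.
by apply: mulfI; rewrite signr_eq0.
Qed.

(* The sign eps is realised by exchanging the two factors, which negates every
   generator; this sign is absorbed in xi on the odd generators. *)
Lemma twist_aut_scalars (eps xi : K) : eps = 1 \/ eps = -1 -> xi != 0 ->
  exists s zt, forall b, twist_aut s zt (xbar K b) =
    (if odd_basis b then xi ^ weight b else eps * xi ^ weight b) *: xbar K b.
Proof.
move=> eE xi0; have [e1|eN1] := eE.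
  exists false, (unit_mk xi0) => b; rewrite twist_aut_xbar e1 !mul1r.
  by rewrite if_same.
have nxi0 : - xi != 0 by rewrite oppr_eq0.
exists true, (unit_mk nxi0) => b; rewrite twist_aut_xbar eN1 expr1 -[val _]/(- xi).
have N1w : (-1 : K) ^ weight b = (-1) ^+ odd_basis b.
  case: b => //=.
  - by rewrite -[LHS]/((-1) ^+ 2)^-1 sqrrN expr1n invr1.
  - by rewrite -[LHS]/((-1) ^+ 1)^-1 expr1 invrN1.
  - by rewrite -[LHS]/((-1) ^+ 2) sqrrN expr1n.
congr (_ *: _); rewrite -[- xi]mulN1r expfzMl mulrA N1w.
by case: (odd_basis b); rewrite ?mulrNN ?mulr1 ?mul1r.
Qed.

Lemma twist_rescaling_bij : bijective twist_rescaling.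
Proof.
have inj : injective twist_rescaling.
  move=> [s xi] [t zt] /(congr1 val)/= /twist_aut_inj[st ->]; congr (_, _).
  by case: s st => [[|[|//]] ?]; case: t => [[|[|//]] ?] // _; apply: val_inj.
(* The constraints give every rescaling the scalars of some twist, and [dra_aut_ext] then identifies
   the two. *)
have surj (r : rescaling_group K) : exists u, twist_rescaling u = r.
  case: r => tau Rtau; have /asboolP[k [tx tH]] := Rtau.
  have [eps [xi [eE [xi0 [kh k1 km1 k2 km2]]]]] := rescaling_scalars tx tH.
  have [s [zt tE]] := twist_aut_scalars eE xi0.
  exists ((if s then 1 else 0), zt); apply: val_inj => /=.
  have -> : ((if s then 1 else 0) == 1 :> 'Z_2) = s by case: (s).
  apply: dra_aut_ext => [b|]; last by rewrite tH; exact: twist_aut_Hbar.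
  by rewrite tE tx; congr (_ *: _); case: b;
    rewrite ?kh ?k1 ?km1 ?k2 ?km2 /= ?expr0z ?mulr1.
pose g r := projT1 (cid (surj r)).
have gK : cancel g twist_rescaling by move=> r; exact: (projT2 (cid (surj r))).
by exists g => // u; apply: inj; rewrite gK.
Qed.

End RescalingGroup.

Theorem proposition4p1 (R : realType) :
  [/\ forall (tau : dra_aut R[i]) (k : osp_basis -> R[i]),
        (forall b, tau (xbar R[i] b) = k b *: xbar R[i] b) ->
        tau (Hbar R[i]) = Hbar R[i] ->
        exists eps xi : R[i],
          (eps = 1 \/ eps = -1) /\ xi != 0 /\
          [/\ k xh = eps, k xp1 = xi, k xm1 = xi^-1,
              k xp2 = eps * xi ^+ 2 & k xm2 = eps * xi ^- 2],
      forall eps xi : R[i], eps = 1 \/ eps = -1 -> xi != 0 ->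
        exists tau : dra_aut R[i],
          (tau (xbar R[i] xp1) = xi *: xbar R[i] xp1 /\
           tau (xbar R[i] xm1) = xi^-1 *: xbar R[i] xm1) /\
          tau (xbar R[i] xh) = eps *: xbar R[i] xh /\
          (tau (xbar R[i] xp2) = (eps * xi ^+ 2) *: xbar R[i] xp2 /\
           tau (xbar R[i] xm2) = (eps * xi ^- 2) *: xbar R[i] xm2) /\
          tau (Hbar R[i]) = Hbar R[i]
    & exists f : {multiplicative ('Z_2 * unit_group R[i])%type
                  -> rescaling_group R[i]}, bijective f].
Proof.
split=> [tau k tx tH|eps xi eE xi0|].
- exact: rescaling_scalars tx tH.
- have [s [zt tE]] := twist_aut_scalars eE xi0; exists (twist_aut s zt).
  by rewrite !tE twist_aut_Hbar /= expr0z mulr1.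
- exists (@twist_rescaling R[i]); exact: twist_rescaling_bij.
Qed.
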